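(* Let $\mathcal L=\mathcal L^h_{N,M}$ and $\|\cdot\|_{\mathcal L}$ be as in the context. Then: (1) $\|\cdot\|_{\mathcal L}$ is a norm on $\mathcal L$; (2) this norm is stronger than the standard operator norm $\|\cdot\|_{\mathcal B}$ of bounded operators on $L^2([0,1)^N,\mathbb C^M)$; (3) convergence of a sequence in $\mathcal L$ with respect to $\|\cdot\|_{\mathcal L}$ is equivalent to uniform convergence of all its coefficient functions $\mathbf A_\alpha$; (4) $(\mathcal L,\|\cdot\|_{\mathcal L})$, with composition of operators as multiplication, is an associative (not necessarily commutative) Banach algebra; in particular $\mathcal A\mathcal B\in\mathcal L$ and $\|\mathcal A\mathcal B\|_{\mathcal L}\le\|\mathcal A\|_{\mathcal L}\|\mathcal B\|_{\mathcal L}$ for all $\mathcal A,\mathcal B\in\mathcal L$.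
   Context: Let $N,M,p$ be positive integers and $h=1/p$. Let $I_N$ be the set of all subsets of $\{1,\dots,N\}$; for $\alpha\in I_N$, $|\alpha|$ is its cardinality and $\bar\alpha$ its complement in $\{1,\dots,N\}$. For $\mathbf x=(x_i)$ write $\mathbf x_\alpha=(x_i)_{i\in\alpha}\in[0,1)^{|\alpha|}$, components in increasing order of indices. For disjoint $\alpha,\beta$, $\mathbf y_\beta\diamond\mathbf x_\alpha=\mathbf x_\alpha\diamond\mathbf y_\beta=\mathbf z_{\alpha\cup\beta}$ where $z_i=x_i$ for $i\in\alpha$ and $z_i=y_i$ for $i\in\beta$. Write $\langle f\rangle_\alpha=\int_{[0,1)^{|\alpha|}}f\,d\mathbf x_\alpha$ with $d\mathbf x_\alpha=\prod_{i\in\alpha}dx_i$, and $\langle f\rangle_\emptyset=f$. Let $\chi^h_i$ be the indicator of $[i/p,(i+1)/p)$. A function $A(y_1,\dots,y_R)$ on $[0,1)^R$ is $h$-staircase if it is a finite linear combination of functions $\prod_{j=1}^R\chi^h_{i_j}(y_j)$; a matrix-valued function is $h$-staircase if all its entries are. $\mathcal L^h_{N,M}$ is the set of operators $\mathcal A$ on $L^2([0,1)^N,\mathbb C^M)$ of the form $(\mathcal A\mathbf u)(\mathbf k)=\sum_{\alpha\in I_N}\langle\mathbf A_\alpha(\mathbf k,\mathbf x_\alpha)\mathbf u(\mathbf k_{\bar\alpha}\diamond\mathbf x_\alpha)\rangle_\alpha$, $\mathbf k\in[0,1)^N$, where each $\mathbf A_\alpha=(a_{i,j,\alpha})_{i,j=1}^M$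 is an $h$-staircase $M\times M$ matrix-valued function of $(\mathbf k,\mathbf x_\alpha)\in[0,1)^N\times[0,1)^{|\alpha|}$ (these coefficients are uniquely determined by $\mathcal A$). Define $\|\mathcal A\|_{\mathcal L}=\sum_{\alpha\in I_N}\max_{(\mathbf k,\mathbf x_\alpha),\,i}\sum_{j=1}^M|a_{i,j,\alpha}(\mathbf k,\mathbf x_\alpha)|$. *)

(* Defs.v *)
From HB Require Import structures.
From mathcomp Require Import all_boot all_order all_algebra.
From mathcomp Require Import all_classical all_reals all_analysis.
From mathcomp.real_closed Require Import complex.
Import Order.TTheory GRing.Theory Num.Theory.

Set Implicit Arguments.
Unset Strict Implicit.
Unset Printing Implicit Defensive.

Local Open Scope ring_scope.
Local Open Scope classical_set_scope.

Section LhNM.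
Variable R : realType.
(* N = number of variables, M = size of the vectors, p = 1/h *)
Variables N M p : nat.

Local Notation C := R[i].
Local Notation leb := (@lebesgue_measure.lebesgue_measure R).

Definition cabs (z : C) : R := Normc.normc z.

Definition in01 (t : R) : bool := (0 <= t) && (t < 1).

Definition cube n (x : n.-tuple R) : Prop := forall i : 'I_n, in01 (tnth x i).

Definition chi (i : nat) (t : R) : R :=
  if (i%:R / p%:R <= t) && (t < i.+1%:R / p%:R) then 1 else 0.

Definition staircase n m (f : n.-tuple R -> m.-tuple R -> C) : Prop :=
  exists c : {ffun 'I_n -> 'I_p} -> {ffun 'I_m -> 'I_p} -> C,
    forall k y, cube k -> cube y ->
      f k y = \sum_(iota : {ffun 'I_n -> 'I_p}) \sum_(kappa : {ffun 'I_m -> 'I_p})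
                c iota kappa *
                Complex ((\prod_(j < n) chi (iota j) (tnth k j)) *
                         (\prod_(j < m) chi (kappa j) (tnth y j))) 0.

(* A family of coefficients (A_alpha)_{alpha in I_N}: A_alpha(k, x_alpha) is an
   M x M complex matrix, k in [0,1)^N, x_alpha in [0,1)^|alpha| (components of
   x_alpha listed in increasing order of the indices in alpha). *)
Definition coefs := forall alpha : {set 'I_N},
  N.-tuple R -> #|alpha|.-tuple R -> 'M[C]_M.

Definition is_stair (A : coefs) : Prop :=
  forall (alpha : {set 'I_N}) (i j : 'I_M),
    staircase (fun k x => A alpha k x i j).

Definition mergeL (alpha : {set 'I_N}) (k : N.-tuple R) (x : #|alpha|.-tuple R)
  : N.-tuple R :=
  [tuple (if i \in alpha then nth 0 x (index i (enum alpha)) else tnth k i)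
  | i < N].
Arguments mergeL : clear implicits.

Fixpoint rint (n : nat) : (n.-tuple R -> R) -> R :=
  match n with
  | 0 => fun g => g [tuple]
  | n'.+1 => fun g =>
      Rintegral leb `[0%R, 1%R[ (fun t => rint (fun y => g (cons_tuple t y)))
  end.

Fixpoint eint (n : nat) : (n.-tuple R -> \bar R) -> \bar R :=
  match n with
  | 0 => fun g => g [tuple]
  | n'.+1 => fun g =>
      (\int[leb]_(t in `[0%R, 1%R[) eint (fun y => g (cons_tuple t y)))%E
  end.

Definition cint n (g : n.-tuple R -> C) : C :=
  Complex (rint (fun x => complex.Re (g x))) (rint (fun x => complex.Im (g x))).

(* functions [0,1)^N -> C^M *)
Definition vfun := N.-tuple R -> 'I_M -> C.

Definition l2sq (u : vfun) : \bar R :=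
  eint (fun k => (\sum_(j < M) cabs (u k j) ^+ 2)%:E).

Definition l2norm (u : vfun) : \bar R :=
  match l2sq u with
  | EFin r => (Num.sqrt r)%:E
  | _ => +oo%E
  end.

Definition isL2 (u : vfun) : Prop :=
  (forall j : 'I_M,
      measurable_fun [set: N.-tuple R] (fun k => complex.Re (u k j)) /\
      measurable_fun [set: N.-tuple R] (fun k => complex.Im (u k j))) /\
  (l2sq u < +oo)%E.

Definition vsub (u v : vfun) : vfun := fun k j => u k j - v k j.

Definition actL (A : coefs) (u : vfun) : vfun := fun k i =>
  \sum_(alpha : {set 'I_N})
     cint (fun x : #|alpha|.-tuple R =>
             \sum_(j < M) A alpha k x i j * u (mergeL alpha k x) j).

Definition normB (A : coefs) : \bar R :=
  ereal_sup [set l2norm (actL A u) | u in [set u | isL2 u /\ (l2norm u <= 1)%E]].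

Definition normL (A : coefs) : R :=
  \sum_(alpha : {set 'I_N})
     sup [set r : R | exists (k : N.-tuple R) (x : #|alpha|.-tuple R) (i : 'I_M),
            [/\ cube k, cube x & r = \sum_(j < M) cabs (A alpha k x i j)]].

Definition addL (A B : coefs) : coefs := fun alpha k x => A alpha k x + B alpha k x.
Definition subL (A B : coefs) : coefs := fun alpha k x => A alpha k x - B alpha k x.
Definition scaleL (c : C) (A : coefs) : coefs := fun alpha k x => c *: A alpha k x.

End LhNM.

Arguments mergeL {R N} alpha k x.

(* Main.v *)
Require Import Defs.
From HB Require Import structures.
From mathcomp Require Import all_boot all_order all_algebra.
From mathcomp Require Import all_classical all_reals all_analysis.
From mathcomp Require Import measurable_realfun simple_functions.
From mathcomp.real_closed Require Import complex.
From mathcomp Require Import ring lra.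
Import Order.TTheory GRing.Theory Num.Theory.
Local Open Scope ring_scope.
Set Implicit Arguments.
Unset Strict Implicit.
Unset Printing Implicit Defensive.

(** An operator of the algebra is determined by the values of its coefficients on
    the cells of the grid of step 1/p, so most claims reduce to finite sums.

    Boundedness: on the unit cube <|u|>_alpha^2 <= <|u|^2>_alpha, used in the form
    2 l <|u|>_alpha <= <|u|^2>_alpha + l^2 followed by the optimal choice of l.

    Uniqueness: apply the operator to the indicator of a cell of the grid of step
    1/(2p) and evaluate in another such cell, which differs from the first one
    exactly in the directions of alpha; only the coefficients of supersets of
    alpha contribute, and downward induction on alpha isolates A_alpha.

    Composition: by Tonelli <<f>_beta>_alpha = <f>_(alpha U beta), and integrating
    the indicator of a middle cell over the directions alpha /\ beta contributes
    p^-|alpha /\ beta|.  This is proved for nonnegative functions and carried over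
    to signed ones at the points where H = sum_gamma <1 + |u|^2>_gamma is finite,
    that is almost everywhere; a point where H is finite sees only convergent
    iterated integrals. *)

(** * Integrals over [0, 1) *)

Section OneVariable.
Import HBNNSimple.
Local Open Scope classical_set_scope.
Context {R : realType}.
Local Notation leb := (@lebesgue_measure.lebesgue_measure R).
Local Notation D := (`[0%R, 1%R[%classic : set R).
Implicit Types (f g h : R -> \bar R).

(** The obstacle is that [Rintegral] gives a number to divergent integrals too, so additivity and
    exchange of order fail at some points, and the inner factor [actL B u] of a composition is not
    known to be measurable. Monotonicity and null-set arguments are therefore proved without
    measurability, and identities between signed integrals are claimed only where a control function
    is finite.

    The grid is halved in the uniqueness argument because on the grid of step 1/p the cells of the
    evaluation point and of the integrated point may coincide in a direction of alpha (always, if p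
    = 1); then the coefficient of a smaller set contributes as well and cannot be told apart. Two
    halves of the same cell have equal coefficients but disjoint indicators.

    The inequality for products holds with constant exactly 1 because, for fixed outer cells and
    index sets, the weights of the middle cells sum to at most 1. The constant in the comparison
    with the operator norm is crude: twice the number of index sets times [M], where the 2 comes
    from estimating real and imaginary parts separately. *)

Definition int01 f : \bar R := (\int[leb]_(t in `[0%R, 1%R[) f t)%E.

Lemma in01E (t : R) : in01 t <-> D t.
Proof. by rewrite /in01 /= in_itv /=. Qed.

Lemma measurable_D : measurable D. Proof. exact: measurable_itv. Qed.

Lemma leb_D : leb D = 1%E.
Proof. by rewrite lebesgue_measure_itv /= lte_fin ltr01 oppr0 adde0. Qed.

Lemma int01_eq f g : (forall t, in01 t -> f t = g t) -> int01 f = int01 g.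
Proof. by move=> fg; apply: eq_integral => t; rewrite inE => /in01E /fg. Qed.

Lemma int01_ge0 f : (forall t, in01 t -> (0 <= f t)%E) -> (0 <= int01 f)%E.
Proof. by move=> f0; apply: integral_ge0 => t /in01E /f0. Qed.

(* Convertible to the lower integral hidden in the library's [integral]. *)
Definition nnintegral d (T : measurableType d) (mu : {measure set T -> \bar R})
    (f : T -> \bar R) := ereal_sup [set sintegral mu h |
  h in [set h : {nnsfun T >-> R} | forall x, ((h x)%:E <= f x)%E]].

Lemma ge0_nnintegralE d (T : measurableType d) (mu : {measure set T -> \bar R})
    (A : set T) (f : T -> \bar R) : (forall x, A x -> (0 <= f x)%E) ->
  (\int[mu]_(x in A) f x)%E = nnintegral mu (f \_ A).
Proof. exact: ge0_integralE. Qed.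

Lemma nnintegral_nnsfun d (T : measurableType d) (mu : {measure set T -> \bar R})
    (h : {nnsfun T >-> R}) : nnintegral mu (EFin \o h) = sintegral mu h.
Proof.
apply/eqP; rewrite eq_le; apply/andP; split.
  by apply/ge_ereal_sup => /= _ -[g /= gh <-]; rewrite le_sintegral.
by apply: ereal_sup_ubound => /=; exists h.
Qed.

Lemma nnintegral_le d (T : measurableType d) (mu : {measure set T -> \bar R})
    (f g : T -> \bar R) :
  (forall t, (f t <= g t)%E) -> (nnintegral mu f <= nnintegral mu g)%E.
Proof.
move=> fg; apply: ge_ereal_sup => _ [h /= hf <-].
apply: ereal_sup_ubound; exists h => // t.
by apply: (le_trans (hf t)); exact: fg.
Qed.

(* The integral of a nonnegative function is a supremum over simple functions,
   so monotonicity needs no measurability. *)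
Lemma int01_le f g : (forall t, in01 t -> (0 <= f t <= g t)%E) -> (int01 f <= int01 g)%E.
Proof.
move=> fg; rewrite /int01 !ge0_nnintegralE; last 2 first.
- by move=> t /in01E /fg /andP[f0 /(le_trans f0)].
- by move=> t /in01E /fg /andP[].
apply: nnintegral_le => t; rewrite /patch; case: ifPn => //.
by rewrite inE => /in01E /fg /andP[].
Qed.

Lemma int01_cst (c : \bar R) : int01 (fun=> c) = c.
Proof.
transitivity (c * leb D)%E; last by rewrite leb_D mule1.
by apply: (@integral_cst _ _ _ leb D); exact: measurable_D.
Qed.

(** Cutting a simple minorant of [f] off on [N] does not change its integral and turns it into a
    minorant of [g]. The argument works with lower integrals, so it also covers non-measurable
    functions. *)
Lemma nnintegral_null_le d (T : measurableType d) (mu : {measure set T -> \bar R})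
    (f g : T -> \bar R) (N : set T) : measurable N -> mu N = 0%E ->
  (forall t, (0 <= g t)%E) -> (forall t, ~ N t -> f t = g t) ->
  (nnintegral mu f <= nnintegral mu g)%E.
Proof.
move=> mN N0 g0 fg; apply: ge_ereal_sup => _ [h /= hf <-].
pose h' := (h \* indic_nnsfun R (measurableC mN))%R : {nnsfun T >-> R}.
have -> : sintegral mu h = sintegral mu h'.
  rewrite -!nnintegral_nnsfun.
  have nnE (u : {nnsfun T >-> R}) :
      nnintegral mu (EFin \o u) = (\int[mu]_x (EFin \o u) x)%E.
    by rewrite ge0_nnintegralE ?patch_setT// => x _; rewrite /= lee_fin.
  rewrite !nnE; apply: ge0_ae_eq_integral; [exact: measurableT|
    exact/measurable_EFinP|exact/measurable_EFinP|by move=> x _; rewrite /= lee_fin|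
    by move=> x _; rewrite /= lee_fin ?mulr_ge0|].
  exists N; split=> // x /= /not_implyP[_]; apply: contra_notP => Nx.
  by rewrite /= mindicE mem_set//= mulr1.
apply: ereal_sup_ubound; exists h' => //= t.
rewrite /= mindicE; have [tN|tN] := pselect (N t).
  by rewrite memNset/= ?mulr0//.
by rewrite mem_set//= mulr1 -fg.
Qed.

(** The integral is the difference of the lower integrals of the positive and negative parts, and
    the null-set comparison applies to each of them in both directions. *)
Lemma int01_null_eq f g (N : set R) : measurable N -> leb N = 0%E ->
  (forall t, in01 t -> ~ N t -> f t = g t) -> int01 f = int01 g.
Proof.
move=> mN N0 fg.
have fgD t : ~ N t -> (f \_ D) t = (g \_ D) t.
  by move=> Nt; rewrite /patch; case: ifPn => //; rewrite inE => /in01E/fg ->.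
have H (u v : R -> \bar R) : (forall t, ~ N t -> u t = v t) -> (forall t, 0 <= u t)%E ->
   (forall t, 0 <= v t)%E -> nnintegral leb u = nnintegral leb v.
  move=> uv u0 v0; apply/eqP; rewrite eq_le; apply/andP; split.
    exact: (@nnintegral_null_le _ _ leb _ _ N).
  by apply: (@nnintegral_null_le _ _ leb _ _ N) => // t /uv.
by rewrite /int01 /integral; congr (_ - _)%E; apply: H => // t Nt;
  rewrite ?funeposE ?funenegE ?fgD.
Qed.

Lemma int01Zl f (c : \bar R) : measurable_fun setT f ->
  (forall t, in01 t -> (0 <= f t)%E) -> (0 <= c)%E ->
  int01 (fun t => (c * f t)%E) = (c * int01 f)%E.
Proof.
move=> mf f0 c0; by rewrite /int01 ge0_integralZl//; exact: measurable_funTS.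
Qed.

Lemma int01D f g : measurable_fun setT f -> measurable_fun setT g ->
  (forall t, in01 t -> (0 <= f t)%E) -> (forall t, in01 t -> (0 <= g t)%E) ->
  int01 (fun t => (f t + g t)%E) = (int01 f + int01 g)%E.
Proof.
move=> mf mg f0 g0; by rewrite /int01 ge0_integralD//; exact: measurable_funTS.
Qed.

Lemma measurable_infty h : measurable_fun setT h -> measurable [set t | h t = +oo%E].
Proof.
move=> mh; have := mh measurableT [set +oo%E] (emeasurable_set1 _).
by rewrite setTI.
Qed.

Lemma int01_infty_null h : measurable_fun setT h -> (forall t, in01 t -> (0 <= h t)%E) ->
  (int01 h < +oo)%E -> leb (D `&` [set t | h t = +oo%E]) = 0%E.
Proof.
move=> mh h0 hoo.
have ih : leb.-integrable D h.
  apply/integrableP; split; first exact: measurable_funTS.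
  rewrite (_ : (\int[_]_(_ in _) _ = int01 h)%E)//; apply: eq_integral => t.
  by rewrite inE => /in01E /h0 /gee0_abs.
have [|N [mN N0 sub]] := integrable_ae _ ih; first exact: measurable_D.
apply: (subset_measure0 _ mN) => //.
  by apply: measurableI; [exact: measurable_D|exact: measurable_infty].
by move=> t [Dt ht]; apply: sub => /= /(_ Dt); rewrite ht.
Qed.

Lemma int01_ind_infty h : measurable_fun setT h -> (forall t, in01 t -> (0 <= h t)%E) ->
  (int01 h < +oo)%E -> int01 (fun t => if h t == +oo%E then +oo%E else 0%E) = 0%E.
Proof.
move=> mh h0 hoo; rewrite (@int01_null_eq _ (fun=> 0%E) (D `&` [set t | h t = +oo%E])).
- exact: int01_cst.
- by apply: measurableI; [exact: measurable_D|exact: measurable_infty].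
- exact: int01_infty_null.
- move=> t /in01E Dt N; case: eqP => // ht; case: N; split=> //.
Qed.

(* [f] need not be measurable: it only has to agree with [f1 - f2] off the
   null set where [h] is infinite. *)
Lemma Rintegral_sub (f : R -> R) f1 f2 h (c : R) :
  measurable_fun setT f1 -> measurable_fun setT f2 -> measurable_fun setT h ->
  0 <= c ->
  (forall t, in01 t -> (0 <= f1 t <= c%:E * h t)%E) ->
  (forall t, in01 t -> (0 <= f2 t <= c%:E * h t)%E) ->
  (forall t, in01 t -> (0 <= h t)%E) -> (int01 h < +oo)%E ->
  (forall t, in01 t -> (h t < +oo)%E -> f t = fine (f1 t) - fine (f2 t)) ->
  Rintegral leb D f = fine (int01 f1) - fine (int01 f2).
Proof.
move=> m1 m2 mh c0 f1h f2h h0 hoo fE.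
pose N := (D `&` [set t | h t = +oo%E]).
have mN : measurable N.
  by apply: measurableI; [exact: measurable_D|exact: measurable_infty].
have N0 : leb N = 0%E by exact: int01_infty_null.
have hN t : in01 t -> ~ N t -> (h t < +oo)%E.
  by move=> /in01E Dt Nt; rewrite ltey; apply/eqP => ht; apply: Nt.
have fin g t : (0 <= g t <= c%:E * h t)%E -> in01 t -> ~ N t -> g t \is a fin_num.
  move=> /andP[g0 gh] t01 Nt; rewrite ge0_fin_numE// (le_lt_trans gh)//.
  by rewrite lte_mul_pinfty//; exact: hN.
have int g : measurable_fun setT g -> (forall t, in01 t -> (0 <= g t <= c%:E * h t)%E) ->
    leb.-integrable D (fun t => (fine (g t))%:E) /\
    (\int[leb]_(t in D) (fine (g t))%:E)%E = int01 g.
  move=> mg gh.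
  have E : (\int[leb]_(t in D) (fine (g t))%:E)%E = int01 g.
    apply: (int01_null_eq mN N0) => t t01 Nt; rewrite fineK//.
    exact: fin (gh _ t01) t01 Nt.
  split=> //; apply/integrableP; split.
    by apply/measurable_EFinP; apply: measurable_funTS; exact: measurableT_comp.
  rewrite (_ : (\int[_]_(_ in _) _ = int01 g)%E).
    apply: le_lt_trans (int01_le gh) _.
    rewrite int01Zl; [|exact: mh|exact: h0|by rewrite lee_fin].
    by rewrite lte_mul_pinfty.
  rewrite -E; apply: eq_integral => t; rewrite inE => /in01E t01.
  rewrite gee0_abs// lee_fin fine_ge0//.
  by have /andP[] := gh _ t01.
have [i1 E1] := int _ m1 f1h; have [i2 E2] := int _ m2 f2h.
rewrite /Rintegral.
rewrite (_ : (\int[_]_(_ in _) _ = \int[leb]_(t in D) ((fine (f1 t))%:E - (fine (f2 t))%:E))%E).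
  rewrite integralB; [|exact: measurable_D|exact: i1|exact: i2].
  have fi g : leb.-integrable D g -> (\int[leb]_(t in D) g t)%E \is a fin_num.
    by apply: integrable_fin_num; exact: measurable_D.
  by rewrite fineB ?fi// E1 E2.
apply: (int01_null_eq mN N0) => t t01 Nt.
by rewrite fE//; exact: hN.
Qed.

Lemma Rintegral_eq01 (f g : R -> R) : (forall t, in01 t -> f t = g t) ->
  Rintegral leb D f = Rintegral leb D g.
Proof.
move=> fg; congr fine; apply: int01_eq => t /fg ->//.
Qed.

Lemma abs_Rintegral_le (f : R -> R) g : (forall t, in01 t -> (`|f t|%:E <= g t)%E) ->
  (`|Rintegral leb D f|%:E <= int01 g)%E.
Proof.
move=> fg.
have H u : (forall t, 0 <= u t)%E -> (forall t, in01 t -> (u t <= g t)%E) ->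
    (nnintegral leb (u \_ D) <= int01 g)%E.
  move=> u0 ug; rewrite -ge0_nnintegralE; last by move=> t _; exact: u0.
  by apply: int01_le => t t01; rewrite u0 ug.
have Hp : (nnintegral leb (((EFin \o f) \_ D)^\+)%E <= int01 g)%E.
  rewrite funepos_restrict; apply: H => t; first exact: funepos_ge0.
  move=> /fg; apply: le_trans.
  by rewrite funeposE -EFin_max lee_fin ge_max ler_norm normr_ge0.
have Hn : (nnintegral leb (((EFin \o f) \_ D)^\-)%E <= int01 g)%E.
  rewrite funeneg_restrict; apply: H => t; first exact: funeneg_ge0.
  move=> /fg; apply: le_trans.
  by rewrite funenegE -EFin_max lee_fin ge_max -normrN ler_norm normr_ge0.
have nn u : (forall t, 0 <= u t)%E -> (0 <= nnintegral leb u)%E.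
  move=> u0; have := @integral_ge0 _ _ _ leb setT u (fun t _ => u0 t).
  by rewrite ge0_nnintegralE// patch_setT.
rewrite /Rintegral.
have -> : (\int[leb]_(t in D) (f t)%:E)%E = (nnintegral leb (((EFin \o f) \_ D)^\+)%E
  - nnintegral leb (((EFin \o f) \_ D)^\-)%E)%E by [].
set a := nnintegral _ _ in Hp *; set b := nnintegral _ _ in Hn *.
have a0 : (0 <= a)%E by apply: nn => t; exact: funepos_ge0.
have b0 : (0 <= b)%E by apply: nn => t; exact: funeneg_ge0.
have g0 : (0 <= int01 g)%E by exact: (le_trans a0 Hp).
(* If one of the two parts has infinite integral, so is their difference, and [fine] sends it to 0;
   the bound is then trivial. *)
move: a b a0 b0 Hp Hn => [a| |] [b| |] //=; rewrite ?normr0 //.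
rewrite !lee_fin => a0 b0 Ha Hb.
have [ab|ab] := leP b a.
  by rewrite ger0_norm ?subr_ge0//; apply: (le_trans _ Ha); rewrite lee_fin gerBl.
rewrite ltr0_norm ?subr_lt0// opprB.
by apply: (le_trans _ Hb); rewrite lee_fin gerBl.
Qed.

End OneVariable.

(** * Iterated integrals of nonnegative functions *)

Section Iterated.
Local Open Scope classical_set_scope.
Context {R : realType}.
Local Notation leb := (@lebesgue_measure.lebesgue_measure R).
Local Notation D := (`[0%R, 1%R[%classic : set R).

Lemma int01_patch (f : R -> \bar R) : int01 f = (\int[leb]_t (f \_ D) t)%E.
Proof. by rewrite /int01 integral_mkcond. Qed.

Lemma measurable_inD : measurable_fun setT (fun t : R => t \in D).
Proof.
apply: (@measurable_fun_bool _ _ _ _ true).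
rewrite (_ : _ @^-1` _ = D).
  by rewrite setTI; exact: measurable_D.
by apply/seteqP; split => t /=; [move/set_mem|move/mem_set].
Qed.

Lemma measurable_patch2 d (X : measurableType d) (F : X * R -> \bar R) :
  measurable_fun setT F ->
  measurable_fun setT (fun z : X * R => if z.2 \in D then F z else 0%E).
Proof.
move=> mF; apply: measurable_fun_ifT => //.
by apply: (measurableT_comp measurable_inD).
Qed.

Lemma measurable_int01 d (X : measurableType d) (F : X * R -> \bar R) :
  measurable_fun setT F -> (forall z, 0 <= F z)%E ->
  measurable_fun setT (fun x => int01 (fun t => F (x, t))).
Proof.
move=> mF F0.
have m := @measurable_fun_fubini_tonelli_F _ _ X _ R leb _ (measurable_patch2 mF).
apply: (eq_measurable_fun (fubini_F leb (fun z : X * R => if z.2 \in D then F z else 0%E))).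
  by move=> x _; rewrite int01_patch.
by apply: m => z; case: ifP.
Qed.

(** Tonelli on the plane for the extension of [F] by zero outside the unit square. *)
Lemma int01_swap (F : R * R -> \bar R) :
  measurable_fun setT F -> (forall z, 0 <= F z)%E ->
  int01 (fun s => int01 (fun t => F (s, t))) = int01 (fun t => int01 (fun s => F (s, t))).
Proof.
move=> mF F0.
pose G (z : R * R) := if z.1 \in D then (if z.2 \in D then F z else 0%E) else 0%E.
have mG : measurable_fun setT G.
  apply: measurable_fun_ifT => //; last exact: measurable_patch2.
  by apply: (measurableT_comp measurable_inD).
have G0 z : (0 <= G z)%E by rewrite /G; case: ifP => // _; case: ifP.
have := @fubini_tonelli _ _ _ _ R leb leb G mG G0.
rewrite int01_patch => iint.
transitivity (\int[leb]_x \int[leb]_y G (x, y))%E.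
  apply: eq_integral => s _; rewrite /patch; case: ifPn => sD.
    by rewrite int01_patch; apply: eq_integral => t _; rewrite /patch /G /= sD.
  by rewrite -[LHS](@integral0 _ _ R leb setT); apply: eq_integral => t _;
    rewrite /G /= (negbTE sD).
rewrite iint int01_patch.
apply: eq_integral => s _; rewrite /patch; case: ifPn => sD.
  by rewrite int01_patch; apply: eq_integral => t _; rewrite /patch /G /= sD.
by rewrite -[RHS](@integral0 _ _ R leb setT); apply: eq_integral => t _;
    rewrite /G /= (negbTE sD); case: ifP.
Qed.

Context {N : nat}.
Local Notation T := (N.-tuple R).
Implicit Types (f g : T -> \bar R) (k y : T) (s : seq 'I_N) (a b : 'I_N).

Definition upd k a (t : R) : T := [tuple (if i == a then t else tnth k i) | i < N].

Lemma tnth_upd k a t i : tnth (upd k a t) i = if i == a then t else tnth k i.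
Proof. by rewrite tnth_mktuple. Qed.

Lemma upd_upd k a t u : upd (upd k a t) a u = upd k a u.
Proof. by apply: eq_from_tnth => i; rewrite !tnth_upd; case: (i == a). Qed.

Lemma updC k a b t u : a != b -> upd (upd k a t) b u = upd (upd k b u) a t.
Proof.
move=> ab; apply: eq_from_tnth => i; rewrite !tnth_upd.
by case: (eqVneq i a) => // ->; rewrite (negbTE ab).
Qed.

Lemma measurable_upd a : measurable_fun setT (fun z : T * R => upd z.1 a z.2).
Proof.
apply/measurable_fun_tnthP => i /=.
rewrite (_ : _ \o _ = if i == a then snd else (fun z : T * R => tnth z.1 i)).
  case: ifP => _ //.
  exact: (measurableT_comp (measurable_tnth i) measurable_fst).
by apply/funext => z /=; rewrite tnth_upd; case: ifP.
Qed.

Lemma measurable_updr k a : measurable_fun setT (fun t : R => upd k a t).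
Proof.
apply/measurable_fun_tnthP => i /=.
rewrite (_ : _ \o _ = if i == a then id else (fun=> tnth k i)).
  by case: ifP.
by apply/funext => z /=; rewrite tnth_upd; case: ifP.
Qed.

(** Integrated coordinates are overwritten in a full point rather than removed, so averages over
    different sets of directions are functions on the same space and can be composed without merging
    points. *)
Fixpoint iint s f k : \bar R :=
  if s is a :: s' then int01 (fun t => iint s' f (upd k a t)) else f k.

Lemma iint_cat s1 s2 f k : iint (s1 ++ s2) f k = iint s1 (iint s2 f) k.
Proof. by elim: s1 k => //= a s1 IH k; apply: int01_eq => t _; exact: IH. Qed.

(** [P] is an invariant of the coordinate updates: [cube] when the pointwise bounds are known only
    there, the trivial predicate otherwise. *)
Lemma iint_le (P : T -> Prop) s f g k :
  (forall y a t, a \in s -> P y -> in01 t -> P (upd y a t)) ->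
  (forall y, P y -> (0 <= f y <= g y)%E) -> P k ->
  (0 <= iint s f k <= iint s g k)%E.
Proof.
elim: s k => [|a s IH] k Pupd fg Pk /=; first exact: fg.
have H t : in01 t -> (0 <= iint s f (upd k a t) <= iint s g (upd k a t))%E.
  move=> t01; apply: IH => //.
    by move=> y b u bs; apply: Pupd; rewrite inE bs orbT.
  by apply: Pupd => //; rewrite mem_head.
by rewrite int01_ge0 ?int01_le// => t /H /andP[].
Qed.

Lemma iint_eq (P : T -> Prop) s f g k :
  (forall y a t, a \in s -> P y -> in01 t -> P (upd y a t)) ->
  (forall y, P y -> f y = g y) -> P k -> iint s f k = iint s g k.
Proof.
elim: s k => [|a s IH] k Pupd fg Pk /=; first exact: fg.
apply: int01_eq => t t01; apply: IH => //.
  by move=> y b u bs; apply: Pupd; rewrite inE bs orbT.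
by apply: Pupd => //; rewrite mem_head.
Qed.

Lemma iint_eqT s f g k : (forall y, f y = g y) -> iint s f k = iint s g k.
Proof. by move=> fg; apply: (@iint_eq (fun=> True)). Qed.

Lemma iint_ge0 s f k : (forall y, 0 <= f y)%E -> (0 <= iint s f k)%E.
Proof.
move=> f0; have /andP[//] : (0 <= iint s f k <= iint s f k)%E.
by apply: (@iint_le (fun=> True)) => // y _; rewrite f0 lexx.
Qed.

Lemma iint_leT s f g k : (forall y, 0 <= f y <= g y)%E -> (iint s f k <= iint s g k)%E.
Proof.
move=> fg; suff /andP[//] : (0 <= iint s f k <= iint s g k)%E.
by apply: (@iint_le (fun=> True)).
Qed.

Definition mpos f := measurable_fun setT f /\ (forall y, 0 <= f y)%E.

Lemma iint_mpos s f : mpos f -> mpos (iint s f).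
Proof.
case=> mf f0; split; last by move=> k; exact: iint_ge0.
elim: s => [//|a s IH] /=.
apply: (@measurable_int01 _ _ (fun z => iint s f (upd z.1 a z.2))).
  by apply: (measurableT_comp IH); exact: measurable_upd.
by move=> z; exact: iint_ge0.
Qed.

Lemma mpos_upd f k a : mpos f -> measurable_fun setT (fun t => f (upd k a t)).
Proof. by case=> mf _; apply: (measurableT_comp mf); exact: measurable_updr. Qed.

Lemma mpos_cst (c : \bar R) : (0 <= c)%E -> mpos (fun=> c).
Proof. by split. Qed.

Lemma mposD f g : mpos f -> mpos g -> mpos (fun y => f y + g y)%E.
Proof.
by move=> [mf f0] [mg g0]; split; [exact: emeasurable_funD|move=> y; rewrite adde_ge0].
Qed.

Lemma mposM f g : mpos f -> mpos g -> mpos (fun y => f y * g y)%E.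
Proof.
by move=> [mf f0] [mg g0]; split; [exact: emeasurable_funM|move=> y; rewrite mule_ge0].
Qed.

Lemma mpos_sum (I : Type) (r : seq I) (P : pred I) (F : I -> T -> \bar R) :
  (forall i, mpos (F i)) -> mpos (fun y => \sum_(i <- r | P i) F i y)%E.
Proof.
move=> mF; elim: r => [|i r IH].
  by under eq_fun do rewrite big_nil; exact: mpos_cst.
under eq_fun do rewrite big_cons.
by case: (P i) => //; exact: mposD.
Qed.

Lemma iint_D s f g k : mpos f -> mpos g ->
  iint s (fun y => f y + g y)%E k = (iint s f k + iint s g k)%E.
Proof.
move=> mf mg; elim: s k => //= a s IH k.
rewrite -int01D; first by apply: int01_eq => t _; exact: IH.
- by apply: (@mpos_upd (iint s _)); apply: iint_mpos.
- by apply: (@mpos_upd (iint s _)); apply: iint_mpos.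
- by move=> t _; exact: (iint_mpos s mf).2.
- by move=> t _; exact: (iint_mpos s mg).2.
Qed.

Lemma iint_sum (I : Type) (r : seq I) (P : pred I) (F : I -> T -> \bar R) s k :
  (forall i, mpos (F i)) ->
  iint s (fun y => \sum_(i <- r | P i) F i y)%E k = (\sum_(i <- r | P i) iint s (F i) k)%E.
Proof.
move=> mF; elim: r => [|i r IH].
  rewrite big_nil (@iint_eqT _ _ (fun=> 0%E)); last by move=> y; rewrite big_nil.
  by elim: s k => //= a s IH k; rewrite -[RHS](@int01_cst R); apply: int01_eq.
rewrite (@iint_eqT _ _ (fun y => (if P i then F i y else 0) + \sum_(i <- r | P i) F i y)%E); last first.
  by move=> y; rewrite big_cons; case: ifP; rewrite ?add0e.
rewrite big_cons; case: ifP => Pi.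
  by rewrite iint_D ?IH//; exact: mpos_sum.
rewrite -IH; apply: iint_eqT => y; rewrite add0e//.
Qed.

Definition indep s (A : Type) (f : T -> A) :=
  forall k a t, a \in s -> f (upd k a t) = f k.

Lemma indep_iint s s' f : indep s' f -> indep s' (iint s f).
Proof.
move=> ind; elim: s => [//|b s IH] k a t as' /=; apply: int01_eq => u _.
have [->|ab] := eqVneq a b; first by rewrite upd_upd.
by rewrite updC// IH.
Qed.

Lemma indep_self s f : indep s (iint s f).
Proof.
elim: s => [//|b s IH] k a t as' /=; apply: int01_eq => u _.
have [->|ab] := eqVneq a b; first by rewrite upd_upd.
by rewrite updC// IH//; move: as'; rewrite inE (negbTE ab).
Qed.

Lemma iint_indep s f k : indep s f -> iint s f k = f k.
Proof.
elim: s k => //= a s IH k ind.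
rewrite -[RHS](@int01_cst R); apply: int01_eq => t _; rewrite IH.
  by rewrite ind// mem_head.
by move=> y b u bs; rewrite ind// inE bs orbT.
Qed.

Lemma iint_cst s (c : \bar R) k : iint s (fun=> c) k = c.
Proof. exact: iint_indep. Qed.

Lemma iint_Zl s f g k : mpos f -> mpos g -> indep s f ->
  iint s (fun y => f y * g y)%E k = (f k * iint s g k)%E.
Proof.
move=> mf mg; elim: s k => //= a s IH k ind.
rewrite -int01Zl; last 3 first.
- by apply: (@mpos_upd (iint s _)); apply: iint_mpos.
- by move=> t _; exact: (iint_mpos s mg).2.
- exact: mf.2.
apply: int01_eq => t _; rewrite IH; first by rewrite ind// mem_head.
by move=> y b u bs; rewrite ind// inE bs orbT.
Qed.

Lemma iint_swap1 a b f k : mpos f -> iint [:: a; b] f k = iint [:: b; a] f k.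
Proof.
move=> mf /=; have [->//|ab] := eqVneq a b.
have [mm f0] := mf.
pose F (z : R * R) := f (upd (upd k a z.1) b z.2).
have mF : measurable_fun setT F.
  have H : measurable_fun setT (fun z : R * R => (upd k a z.1, z.2)).
    apply: measurable_fun_pair; last exact: measurable_snd.
    exact: (measurableT_comp (measurable_updr k a) measurable_fst).
  exact: (measurableT_comp mm (measurableT_comp (measurable_upd b) H)).
apply: (etrans (int01_swap mF (fun z => f0 _))).
by apply: int01_eq => t _; apply: int01_eq => u _; rewrite /F updC.
Qed.

Lemma iint_swap1s a s f k : mpos f -> iint (a :: s) f k = iint (rcons s a) f k.
Proof.
move=> mf; elim: s k => //= b s IH k.
have := @iint_swap1 a b (iint s f) k (iint_mpos s mf) => /= ->.
by apply: int01_eq => t _; rewrite -IH.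
Qed.

Lemma iint_swap s1 s2 f k : mpos f -> iint (s1 ++ s2) f k = iint (s2 ++ s1) f k.
Proof.
move=> mf; elim: s1 s2 k => [|a s1 IH] s2 k; first by rewrite cats0.
rewrite cat_cons iint_swap1s// -cats1 -catA IH.
by rewrite -catA.
Qed.

(** Exchanges of adjacent blocks generate all permutations, and each such exchange is a succession
    of Tonelli swaps of two neighbouring directions. *)
Lemma iint_perm s1 s2 f k : mpos f -> perm_eq s1 s2 -> iint s1 f k = iint s2 f k.
Proof.
move=> mf s12.
apply: (@catCA_perm_ind _ (fun s => iint s1 f k = iint s f k) _ _ _ s12) => //.
move=> u v w ->; rewrite !catA !(iint_cat (_ ++ _)).
by apply: iint_swap; exact: iint_mpos.
Qed.

(** The inner integral no longer depends on a direction of [s2], and averaging a constant over an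
    interval of length 1 returns it. *)
Lemma iint_absorb s1 s2 f k :
  iint (s1 ++ s2) f k = iint ([seq a <- s1 | a \notin s2] ++ s2) f k.
Proof.
elim: s1 k => //= a s1 IH k; case: ifPn => as2 /=.
  by apply: int01_eq => t _.
rewrite -IH -[RHS](@int01_cst R); apply: int01_eq => t _.
rewrite !iint_cat (@indep_iint s1 s2)//; first exact: indep_self.
by move: as2; rewrite negbK.
Qed.

(* The paper's <f>_A, as a function of all the coordinates. *)
Definition iset (A : {set 'I_N}) f k := iint (enum A) f k.

Lemma iset_iset (A B : {set 'I_N}) f k : mpos f -> iset A (iset B f) k = iset (A :|: B) f k.
Proof.
move=> mf; rewrite /iset -iint_cat iint_absorb; apply: iint_perm => //.
apply: uniq_perm; last first.
- move=> i; rewrite mem_cat mem_filter !mem_enum inE.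
  by case: (i \in B); rewrite ?orbT ?orbF.
- exact: enum_uniq.
- rewrite cat_uniq filter_uniq ?enum_uniq//= andbT; apply/hasPn => i iB.
  by rewrite mem_filter iB.
Qed.

End Iterated.

(** * Iterated integrals of real functions *)

Section Signed.
Local Open Scope classical_set_scope.
Context {R : realType} {N : nat}.
Local Notation leb := (@lebesgue_measure.lebesgue_measure R).
Local Notation D := (`[0%R, 1%R[%classic : set R).
Local Notation T := (N.-tuple R).
Implicit Types (k y : T) (s : seq 'I_N) (a b : 'I_N).

Fixpoint riint s f k : R :=
  if s is a :: s' then Rintegral leb D (fun t => riint s' f (upd k a t)) else f k.

Lemma cube_upd k a t : cube k -> in01 t -> cube (upd k a t).
Proof. by move=> ck t01 i; rewrite tnth_upd; case: ifP. Qed.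

Lemma riint_eq (P : T -> Prop) s f g k :
  (forall y a t, a \in s -> P y -> in01 t -> P (upd y a t)) ->
  (forall y, P y -> f y = g y) -> P k -> riint s f k = riint s g k.
Proof.
elim: s k => [|a s IH] k Pupd fg Pk /=; first exact: fg.
apply: Rintegral_eq01 => t t01; apply: IH => //.
  by move=> y b u bs; apply: Pupd; rewrite inE bs orbT.
by apply: Pupd => //; rewrite mem_head.
Qed.

Lemma riint_eq_cube s f g k : (forall y, cube y -> f y = g y) -> cube k ->
  riint s f k = riint s g k.
Proof. by apply: riint_eq => *; exact: cube_upd. Qed.

Lemma abs_riint_le s f (g : T -> \bar R) k :
  (forall y, cube y -> (`|f y|%:E <= g y)%E) -> cube k -> (`|riint s f k|%:E <= iint s g k)%E.
Proof.
move=> fg; elim: s k => [|a s IH] k ck /=; first exact: fg.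
by apply: abs_Rintegral_le => t t01; apply: IH; exact: cube_upd.
Qed.

(** This [+oo]-valued indicator dominates every function that vanishes where [h] is finite, whatever
    its values elsewhere. It turns an identity valid where [h] is finite into a vanishing iterated
    integral. *)
Lemma iint_ind_infty s (h : T -> \bar R) k : mpos h -> (iint s h k < +oo)%E ->
  iint s (fun y => if h y == +oo%E then +oo%E else 0%E) k = 0%E.
Proof.
move=> mh; elim: s k => [|a s IH] k /= hoo; first by rewrite ltey in hoo; rewrite (negbTE hoo).
have mE := iint_mpos s mh.
apply/eqP; rewrite eq_le; apply/andP; split; last first.
  by apply: int01_ge0 => t _; apply: iint_ge0 => y; case: ifP.
(* Where the inner integral of [h] is finite the induction hypothesis gives 0; the remaining [t]
   form a null set, on which [+oo] is allowed. *)
rewrite -[leRHS](@int01_ind_infty _ (fun t => iint s h (upd k a t))); [|exact: mpos_upd|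
  by move=> t _; exact: mE.2|exact: hoo].
apply: int01_le => t _; apply/andP; split; first by apply: iint_ge0 => y; case: ifP.
case: eqP => [_|/eqP ht]; first by rewrite leey.
by rewrite IH// ltey.
Qed.

(** * Signed functions dominated by a control function *)

Section Rep.
Variable H : T -> \bar R.
Hypothesis mH : mpos H.
(** Averaging in one direction costs only a constant factor. Hence, at a point where [H] is finite,
    [H] is integrable along every axis line through that point and so finite at almost all of its
    points. *)
Hypothesis HE : forall a, exists2 c : R, 0 <= c & forall k, (iint [:: a] H k <= c%:E * H k)%E.

Definition dominated (f : T -> \bar R) :=
  exists2 c : R, 0 <= c & forall k, (f k <= c%:E * H k)%E.

(* [f] is a difference of nonnegative functions bounded by multiples of [H],
   at the points of the cube where [H] is finite. *)
Definition rep (f : T -> R) (f1 f2 : T -> \bar R) :=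
  [/\ mpos f1, mpos f2, dominated f1, dominated f2 &
    forall y, cube y -> (H y < +oo)%E -> f y = fine (f1 y) - fine (f2 y)].

Definition tame f := exists f1 f2, rep f f1 f2.

Lemma dominated_fin (f : T -> \bar R) y : mpos f -> dominated f -> (H y < +oo)%E ->
  f y \is a fin_num.
Proof.
move=> [_ f0] [c c0 fH] Hy; rewrite ge0_fin_numE// (le_lt_trans (fH y))//.
by rewrite lte_mul_pinfty// lee_fin.
Qed.

Lemma dominated_iint1 a (f : T -> \bar R) : mpos f -> dominated f -> dominated (iint [:: a] f).
Proof.
move=> mf [c c0 fH]; have [c' c'0 HH] := HE a.
exists (c * c'); rewrite ?mulr_ge0// => k.
apply: (@le_trans _ _ (iint [:: a] (fun y => c%:E * H y)%E k)).
  by apply: iint_leT => y; rewrite mf.2 fH.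
have mc : mpos (fun _ : T => c%:E) by apply: mpos_cst; rewrite lee_fin.
by rewrite (@iint_Zl _ _ _ (fun=> c%:E))// EFinM -muleA lee_wpmul2l ?lee_fin.
Qed.

Lemma rep_riint1 a f f1 f2 : rep f f1 f2 -> rep (riint [:: a] f) (iint [:: a] f1) (iint [:: a] f2).
Proof.
case=> m1 m2 d1 d2 fE; split; [exact: iint_mpos|exact: iint_mpos|exact: dominated_iint1|
  exact: dominated_iint1|].
move=> k ck Hk /=.
have [c1 c10 H1] := d1; have [c2 c20 H2] := d2.
have c0 : 0 <= c1 + c2 by rewrite addr_ge0.
apply: (@Rintegral_sub _ _ _ _ (fun t => H (upd k a t)) (c1 + c2)) => //.
- exact: mpos_upd.
- exact: mpos_upd.
- exact: mpos_upd.
- move=> t _; rewrite m1.2 (le_trans (H1 _))//= lee_wpmul2r ?lee_fin ?lerDl//; exact: mH.2.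
- move=> t _; rewrite m2.2 (le_trans (H2 _))//= lee_wpmul2r ?lee_fin ?lerDr//; exact: mH.2.
- by move=> t _; exact: mH.2.
- have [c c0' HH] := HE a; apply: le_lt_trans (HH k) _.
  by rewrite lte_mul_pinfty// lee_fin.
- by move=> t t01 Ht; apply: fE => //; exact: cube_upd.
Qed.

Lemma rep_riint s f f1 f2 : rep f f1 f2 -> rep (riint s f) (iint s f1) (iint s f2).
Proof. by move=> rf; elim: s => [//|a s IH]; exact: (rep_riint1 a IH). Qed.

Lemma dominatedD (f g : T -> \bar R) : dominated f -> dominated g ->
  dominated (fun y => f y + g y)%E.
Proof.
move=> [c c0 fH] [d d0 gH]; exists (c + d); first by rewrite addr_ge0.
by move=> k; rewrite EFinD ge0_muleDl ?lee_fin//; exact: leeD.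
Qed.

Lemma rep_D f g f1 f2 g1 g2 : rep f f1 f2 -> rep g g1 g2 ->
  rep (fun y => f y + g y) (fun y => f1 y + g1 y)%E (fun y => f2 y + g2 y)%E.
Proof.
move=> [mf1 mf2 df1 df2 fE] [mg1 mg2 dg1 dg2 gE].
split; [exact: mposD|exact: mposD|exact: dominatedD|exact: dominatedD|].
move=> y cy Hy; rewrite !fineD ?dominated_fin// fE// gE//.
by rewrite opprD addrACA.
Qed.

Lemma rep_M (p : T -> R) f f1 f2 : measurable_fun setT p -> (forall y, 0 <= p y <= 1) ->
  rep f f1 f2 ->
  rep (fun y => p y * f y) (fun y => (p y)%:E * f1 y)%E (fun y => (p y)%:E * f2 y)%E.
Proof.
move=> mp p01 [m1 m2 d1 d2 fE].
have mp' : mpos (fun y => (p y)%:E).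
  by split; [exact/measurable_EFinP|move=> y; rewrite lee_fin; case/andP: (p01 y)].
have dM (g : T -> \bar R) : mpos g -> dominated g -> dominated (fun y => (p y)%:E * g y)%E.
  move=> mg [c c0 gH]; exists c => // k; apply: le_trans (gH k).
  rewrite -[leRHS]mul1e lee_wpmul2r ?lee_fin//; last by case/andP: (p01 k).
  exact: mg.2.
split; [exact: mposM|exact: mposM|exact: dM|exact: dM|].
by move=> y cy Hy; rewrite !fineM ?dominated_fin//= fE// mulrBr.
Qed.

Lemma rep_scale (c : R) f f1 f2 : 0 <= c -> rep f f1 f2 ->
  rep (fun y => c * f y) (fun y => c%:E * f1 y)%E (fun y => c%:E * f2 y)%E.
Proof.
move=> c0 [m1 m2 d1 d2 fE].
have mc : mpos (fun _ : T => c%:E) by apply: mpos_cst; rewrite lee_fin.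
have dM (g : T -> \bar R) : mpos g -> dominated g -> dominated (fun y => c%:E * g y)%E.
  move=> mg [d d0 gH]; exists (c * d); first by rewrite mulr_ge0.
  by move=> k; rewrite EFinM -muleA lee_wpmul2l ?lee_fin.
split; [exact: mposM|exact: mposM|exact: dM|exact: dM|].
by move=> y cy Hy; rewrite !fineM ?dominated_fin//= fE// mulrBr.
Qed.

Lemma rep_N f f1 f2 : rep f f1 f2 -> rep (fun y => - f y) f2 f1.
Proof.
move=> [m1 m2 d1 d2 fE]; split => // y cy Hy.
by rewrite fE// opprB.
Qed.

Lemma tame_D f g : tame f -> tame g -> tame (fun y => f y + g y).
Proof. by move=> [f1 [f2 rf]] [g1 [g2 rg]]; do 2 eexists; exact: rep_D rf rg. Qed.

Lemma tame_Z (c : R) f : tame f -> tame (fun y => c * f y).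
Proof.
move=> [f1 [f2 rf]]; have [c0|c0] := leP 0 c.
  by do 2 eexists; exact: rep_scale rf.
have c0' : 0 <= - c by rewrite oppr_ge0 ltW.
rewrite (_ : (fun y => c * f y) = (fun y => - (- c * f y))).
  by do 2 eexists; exact: rep_N (rep_scale c0' rf).
by apply/funext => y; rewrite mulNr opprK.
Qed.

Lemma tame_M (p : T -> R) f : measurable_fun setT p -> (forall y, 0 <= p y <= 1) ->
  tame f -> tame (fun y => p y * f y).
Proof. by move=> mp p01 [f1 [f2 rf]]; do 2 eexists; exact: rep_M rf. Qed.

Lemma tame_riint s f : tame f -> tame (riint s f).
Proof. by move=> [f1 [f2 rf]]; do 2 eexists; exact: rep_riint rf. Qed.

(** [g] inherits the representatives of [f], so both integrals equal the same difference of
    nonnegative ones. This transfers the value of the integral to a [g] that may fail to be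
    measurable. *)
Lemma riint_congr s f g k : tame f -> (forall y, cube y -> (H y < +oo)%E -> f y = g y) ->
  cube k -> (H k < +oo)%E -> riint s f k = riint s g k.
Proof.
move=> [f1 [f2 rf]] fg ck Hk.
have rg : rep g f1 f2.
  by case: rf => m1 m2 d1 d2 fE; split => // y cy Hy; rewrite -fg// fE.
have [_ _ _ _ ->//] := rep_riint s rf.
by have [_ _ _ _ ->] := rep_riint s rg.
Qed.

Lemma riint_D s f g k : tame f -> tame g -> cube k -> (H k < +oo)%E ->
  riint s (fun y => f y + g y) k = riint s f k + riint s g k.
Proof.
move=> [f1 [f2 rf]] [g1 [g2 rg]] ck Hk.
have [_ _ _ _ ->//] := rep_riint s (rep_D rf rg).
have [mf1 mf2 df1 df2 ->//] := rep_riint s rf.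
have [mg1 mg2 dg1 dg2 ->//] := rep_riint s rg.
case: rf => ? ? ? ? _; case: rg => ? ? ? ? _.
rewrite !iint_D// !fineD ?dominated_fin//.
by rewrite opprD addrACA.
Qed.

Lemma riint_Z s (c : R) f k : tame f -> cube k -> (H k < +oo)%E ->
  riint s (fun y => c * f y) k = c * riint s f k.
Proof.
move=> [f1 [f2 rf]] ck Hk.
(* A negative factor is a nonnegative one followed by a change of sign, which exchanges the two
   representatives. *)
wlog c0 : c / 0 <= c => [hw|].
  have [|c0] := leP 0 c; first exact: hw.
  have c0' : 0 <= - c by rewrite oppr_ge0 ltW.
  have := hw _ c0'; have rn := rep_scale c0' rf.
  have -> : riint s (fun y => c * f y) k = riint s (fun y => - (- c * f y)) k.
    by apply: (@riint_eq (fun=> True)) => // y _; rewrite mulNr opprK.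
  have [_ _ _ _ ->//] := rep_riint s (rep_N rn).
  have [_ _ _ _ ->//] := rep_riint s rn.
  by move=> iint; rewrite -opprB iint mulNr opprK.
have [_ _ _ _ ->//] := rep_riint s (rep_scale c0 rf).
have [mf1 mf2 df1 df2 ->//] := rep_riint s rf.
case: rf => ? ? ? ? _.
have mc : mpos (fun _ : T => c%:E) by apply: mpos_cst; rewrite lee_fin.
by rewrite !(@iint_Zl _ _ _ (fun=> c%:E))// !fineM ?dominated_fin// mulrBr.
Qed.

(* Two operators on signed functions agree as soon as their counterparts on
   nonnegative functions do. *)
Lemma rep_uniq f g f1 f2 g1 g2 k : rep f f1 f2 -> rep g g1 g2 ->
  f1 k = g1 k -> f2 k = g2 k -> cube k -> (H k < +oo)%E -> f k = g k.
Proof. by move=> [_ _ _ _ fE] [_ _ _ _ gE] e1 e2 ck Hk; rewrite fE// gE// e1 e2. Qed.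

Lemma rep_real (f : T -> R) : measurable_fun setT f -> (forall y, (`|f y|%:E <= H y)%E) ->
  rep f (fun y => (Num.max (f y) 0)%:E) (fun y => (Num.max (- f y) 0)%:E).
Proof.
move=> mf fH.
have dm (g : T -> R) : (forall y, g y <= `|f y|) -> dominated (fun y => (Num.max (g y) 0)%:E).
  move=> gf; exists 1 => // y; rewrite mul1e; apply: le_trans (fH y).
  by rewrite lee_fin ge_max gf normr_ge0.
have mp (g : T -> R) : measurable_fun setT g -> mpos (fun y => (Num.max (g y) 0)%:E).
  move=> mg; split; last by move=> y; rewrite lee_fin le_max lexx orbT.
  by apply/measurable_EFinP; exact: measurable_maxr.
split.
- exact: mp.
- by apply: mp; exact: measurableT_comp.
- by apply: dm => y; exact: ler_norm.
- by apply: dm => y; rewrite -normrN; exact: ler_norm.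
- move=> y _ _ /=; have [f0|f0] := leP 0 (f y).
    by rewrite max_r ?oppr_le0// subr0.
  by rewrite max_l ?oppr_ge0 ?ltW// sub0r opprK.
Qed.

End Rep.

(** * Integrals over tuples as integrals over lists of directions *)

Section Merge.

(** [mergeL] for a list of directions: its recursion on the list matches that of [rint] on the
    length of the tuple. *)
Definition mrg s k (x : seq R) : T :=
  [tuple (if i \in s then nth 0 x (index i s) else tnth k i) | i < N].

Lemma mrg_cons a s k t x : a \notin s -> mrg (a :: s) k (t :: x) = mrg s (upd k a t) x.
Proof.
move=> as'; apply: eq_from_tnth => i; rewrite !tnth_mktuple inE /=.
by have [->|//] := eqVneq i a; rewrite (negbTE as').
Qed.

Lemma mrg_nil k x : mrg [::] k x = k.
Proof. by apply: eq_from_tnth => i; rewrite !tnth_mktuple. Qed.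

Lemma rint_mrg n s (f : T -> R) k : n = size s -> uniq s ->
  rint (fun x : n.-tuple R => f (mrg s k x)) = riint s f k.
Proof.
elim: s n k => [|a s IH] [|n] k //=; first by rewrite mrg_nil.
move=> [ns] /andP[as' us]; apply: Rintegral_eq01 => t _.
rewrite -(IH n)//; congr rint; apply/funext => x.
by rewrite -mrg_cons.
Qed.

Lemma eint_mrg n s (f : T -> \bar R) k : n = size s -> uniq s ->
  eint (fun x : n.-tuple R => f (mrg s k x)) = iint s f k.
Proof.
elim: s n k => [|a s IH] [|n] k //=; first by rewrite mrg_nil.
move=> [ns] /andP[as' us]; apply: int01_eq => t _.
rewrite -(IH n)//; congr eint; apply/funext => x.
by rewrite -mrg_cons.
Qed.

Lemma mergeLE (A : {set 'I_N}) k (x : #|A|.-tuple R) : mergeL A k x = mrg (enum A) k x.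
Proof. by apply: eq_from_tnth => i; rewrite !tnth_mktuple mem_enum. Qed.

Lemma rint_mergeL (A : {set 'I_N}) (f : T -> R) k :
  rint (fun x : #|A|.-tuple R => f (mergeL A k x)) = riint (enum A) f k.
Proof.
rewrite -(@rint_mrg #|A|) ?enum_uniq -?cardE//.
by congr rint; apply/funext => x; rewrite mergeLE.
Qed.

(** Merging over all directions returns [x] itself, so the base point [k] is arbitrary. *)
Lemma eint_iset (f : T -> \bar R) k : eint f = iset [set: 'I_N]%SET f k.
Proof.
rewrite /iset -(@eint_mrg N) ?enum_uniq//; last by rewrite -cardE cardsT card_ord.
congr eint; apply/funext => x; congr f; apply: eq_from_tnth => i.
rewrite tnth_mktuple mem_enum inE (tnth_nth 0) /=.
have -> : enum [set: 'I_N]%SET = enum 'I_N by rewrite enum_setT enumT.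
by rewrite index_enum_ord.
Qed.

Lemma cube_cons n t (x : n.-tuple R) : in01 t -> cube x -> cube (cons_tuple t x).
Proof.
move=> t01 cx i; case: (unliftP ord0 i) => [j ->|->]; last by rewrite tnth0.
by rewrite tnthS.
Qed.

Lemma rint_eq n (f g : n.-tuple R -> R) : (forall x, cube x -> f x = g x) ->
  rint f = rint g.
Proof.
elim: n f g => [|n IH] f g fg /=; first by apply: fg; case.
apply: Rintegral_eq01 => t t01; apply: IH => x cx; apply: fg.
exact: cube_cons.
Qed.

End Merge.
End Signed.

(** * Grid cells *)

Section Cells.
Context {R : realType}.
Variable q : nat.
Hypothesis q0 : (0 < q)%N.
Implicit Types (t : R).

(** The remainder keeps the index in ['I_q] for points outside [0, 1); inside, the truncation is
    already below [q]. *)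
Definition cell1 t : 'I_q := Ordinal (ltn_pmod (Num.truncn (q%:R * t)) q0).

Definition corner1 (i : 'I_q) : R := i%:R / q%:R.

Let q0R : 0 < q%:R :> R. Proof. by rewrite ltr0n. Qed.

Lemma chi_itvE (i : nat) t : chi q i t = (i%:R <= q%:R * t < i.+1%:R)%R%:R.
Proof.
rewrite /chi ler_pdivrMr// ltr_pdivlMr// ![t * _]mulrC.
by case: ifP.
Qed.

Lemma chiE (i : 'I_q) t : in01 t -> chi q i t = (i == cell1 t)%:R.
Proof.
move=> /andP[t0 t1]; rewrite chi_itvE -val_eqE /=.
have qt0 : 0 <= q%:R * t by rewrite mulr_ge0// ltW.
have tq : (Num.truncn (q%:R * t) < q)%N.
  rewrite -(ltr_nat R); apply: le_lt_trans (_ : q%:R * t < _).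
    by have /andP[] := truncn_itv qt0.
  by rewrite gtr_pMr.
by rewrite modn_small// eq_sym truncn_eq.
Qed.

Lemma corner1_in01 i : in01 (corner1 i).
Proof.
rewrite /in01 /corner1 divr_ge0//= ltr_pdivrMr// mul1r ltr_nat//.
Qed.

Lemma corner1K : cancel corner1 cell1.
Proof.
move=> i; apply/esym/eqP; move: (chiE i (corner1_in01 i)).
have e : q%:R * corner1 i = i%:R by rewrite mulrC divfK ?gt_eqF.
rewrite chi_itvE e lexx ltr_nat ltnSn /=.
by case: eqP => // _ /eqP; rewrite oner_eq0.
Qed.

Lemma chi_ge0 (i : nat) t : 0 <= chi q i t :> R.
Proof. by rewrite chi_itvE; case: (_ <= _ < _). Qed.

Lemma chi_le1 (i : nat) t : chi q i t <= 1 :> R.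
Proof. by rewrite chi_itvE; case: (_ <= _ < _). Qed.

Lemma chi_indic (i : nat) :
  chi q i = \1_(`[i%:R / q%:R, i.+1%:R / q%:R[%classic : set R) :> (R -> R).
Proof.
apply/funext => t; rewrite /chi indicE; case: ifP => h.
  by rewrite mem_set//= in_itv.
by rewrite memNset//= in_itv/= h.
Qed.

Lemma measurable_chi (i : nat) : measurable_fun setT (chi q i : R -> R).
Proof. by rewrite chi_indic; apply: measurable_indic; exact: measurable_itv. Qed.

Lemma int01_chi (i : 'I_q) : int01 (fun t => (chi q i t)%:E) = (q%:R^-1 : R)%:E.
Proof.
rewrite /int01 chi_indic integral_indic; [|exact: measurable_itv|exact: measurable_itv].
rewrite setIidl.
  transitivity (lebesgue_measure (`[i%:R / q%:R, i.+1%:R / q%:R[%classic : set R)) => //.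
  rewrite lebesgue_measure_itv /= lte_fin ltr_pM2r ?invr_gt0// ltr_nat ltnSn.
  by rewrite -EFinB -mulrBl -natrB// subSnn mul1r.
move=> t /=; rewrite !in_itv /= => /andP[h1 h2]; apply/andP; split.
  by apply: le_trans h1; rewrite divr_ge0.
by apply: lt_le_trans h2 _; rewrite ler_pdivrMr// mul1r ler_nat.
Qed.

Section Tuples.
Context {n : nat}.
Implicit Types (k y : n.-tuple R).

Definition cell k : {ffun 'I_n -> 'I_q} := [ffun j => cell1 (tnth k j)].
Definition corner (eta : {ffun 'I_n -> 'I_q}) : n.-tuple R :=
  [tuple corner1 (eta j) | j < n].

Lemma cube_corner eta : cube (corner eta).
Proof. by move=> i; rewrite tnth_mktuple corner1_in01. Qed.

Lemma cornerK : cancel corner cell.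
Proof. by move=> eta; apply/ffunP => i; rewrite ffunE tnth_mktuple corner1K. Qed.

(** Partial products occur because averaging over a direction replaces its factor by a constant and
    leaves the others. *)
Definition box (eta : {ffun 'I_n -> 'I_q}) (S : {set 'I_n}) k : R :=
  \prod_(i in S) chi q (eta i) (tnth k i).

Lemma boxE eta S k : cube k ->
  box eta S k = [forall (i | i \in S), eta i == cell k i]%:R.
Proof.
move=> ck; rewrite /box; case: forall_inP => [h|h].
  by rewrite big1// => i iS; rewrite chiE//; move/eqP: (h i iS) => ->; rewrite ffunE eqxx.
have [i iS ne] : exists2 i, i \in S & eta i != cell k i.
  apply: contra_notP h => hn i iS; apply/negPn/negP => ne; apply: hn.
  by exists i.
rewrite (bigD1 i)//= chiE//; move: ne; rewrite ffunE => /negbTE ->.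
by rewrite mul0r.
Qed.

Lemma boxTE eta k : cube k -> box eta [set: _]%SET k = (eta == cell k)%:R.
Proof.
move=> ck; rewrite boxE//; congr (_ %:R); congr nat_of_bool; apply/forall_inP/eqP.
  by move=> h; apply/ffunP => i; apply/eqP/h.
by move=> -> i _.
Qed.

Lemma box_ge0_le1 eta S k : 0 <= box eta S k <= 1.
Proof.
rewrite prodr_ge0/=; last by move=> *; exact: chi_ge0.
by apply: prodr_ile1 => i _; rewrite chi_ge0 chi_le1.
Qed.

Lemma measurable_box eta S : measurable_fun setT (box eta S).
Proof.
rewrite /box; under eq_fun do rewrite big_mkcond.
apply: measurable_prod => i _; case: (i \in S) => //.
exact: (measurableT_comp (measurable_chi (eta i)) (measurable_tnth i)).
Qed.

Lemma mpos_box eta S : mpos (fun y => (box eta S y)%:E).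
Proof.
split; first by apply/measurable_EFinP; apply: measurable_box.
by move=> y; rewrite lee_fin; case/andP: (box_ge0_le1 eta S y).
Qed.

End Tuples.

(** At a point of the cube exactly one product of indicators is nonzero, so staircase functions are
    those constant on pairs of cells, and the coefficient of a pair can be read off at its
    corners. *)
Lemma staircaseP n m (f : n.-tuple R -> m.-tuple R -> R[i]) :
  staircase q f <->
  (forall k y, cube k -> cube y -> f k y = f (corner (cell k)) (corner (cell y))).
Proof.
have sumE (c : {ffun 'I_n -> 'I_q} -> {ffun 'I_m -> 'I_q} -> R[i]) k y :
    cube k -> cube y ->
    \sum_(iota : {ffun 'I_n -> 'I_q}) \sum_(kappa : {ffun 'I_m -> 'I_q})
      c iota kappa * Complex ((\prod_(j < n) chi q (iota j) (tnth k j)) *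
                              (\prod_(j < m) chi q (kappa j) (tnth y j))) 0 =
    c (cell k) (cell y).
  move=> ck cy.
  have H l (x : l.-tuple R) (eta : {ffun 'I_l -> 'I_q}) : cube x ->
      \prod_(j < l) chi q (eta j) (tnth x j) = (eta == cell x)%:R.
    move=> cx; rewrite -boxTE// /box; apply: eq_bigl => i.
    by rewrite inE.
  rewrite (bigD1 (cell k))//= (bigD1 (cell y))//= !H// !eqxx mulr1.
  rewrite big1 => [|eta ne]; last by rewrite !H// (negbTE ne) mulr0 mulr0.
  rewrite addr0 big1 => [|eta ne]; first by rewrite addr0 mulr1.
  by rewrite big1 => // z _; rewrite !H// (negbTE ne) mul0r mulr0.
split=> [[c fc] k y ck cy|h].
  rewrite !fc//; [|exact: cube_corner|exact: cube_corner].
  by rewrite !sumE ?cornerK//; exact: cube_corner.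
exists (fun iota kappa => f (corner iota) (corner kappa)) => k y ck cy.
by rewrite h// sumE.
Qed.

(** * Averages of cell indicators *)

Section Compose.
Context {N : nat}.
Local Notation T := (N.-tuple R).
Local Notation cells := {ffun 'I_N -> 'I_q}.
Implicit Types (eta zeta : cells) (A B S : {set 'I_N}) (k y : T).

Lemma box_upd_out eta S a k t : a \notin S -> box eta S (upd k a t) = box eta S k.
Proof.
move=> aS; apply: eq_bigr => i iS; rewrite tnth_upd.
by case: eqP => // ia; move: aS; rewrite -ia iS.
Qed.

Lemma box_upd_in eta S a k t : a \in S ->
  box eta S (upd k a t) = chi q (eta a) t * box eta (S :\ a) k.
Proof.
move=> aS; rewrite /box (big_setD1 a)//= tnth_upd eqxx; congr (_ * _).
apply: eq_bigr => i; rewrite !inE => /andP[ia _].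
by rewrite tnth_upd (negbTE ia).
Qed.

(** As [g] ignores the directions of [B], integrating in one of them meets only its indicator and
    yields the cell length [1/q]; every other direction passes through to [g]. *)
Lemma iint_box eta B s (g : T -> \bar R) k : uniq s -> indep (enum B) g -> mpos g ->
  iint s (fun y => (box eta B y)%:E * g y)%E k =
  ((q%:R^-1 ^+ count [in B] s * box eta (B :\: [set a in s]) k)%:E *
   iint [seq a <- s | a \notin B] g k)%E.
Proof.
move=> us ind mg; elim: s us k => [|a s IH] /=.
  by move=> _ k; rewrite expr0 mul1r (_ : _ :\: _ = B)//; apply/setP => i; rewrite !inE.
move=> /andP[as' us] k.
set s' := [seq a <- s | a \notin B].
have c0 : 0 <= q%:R^-1 ^+ count [in B] s :> R by rewrite exprn_ge0// invr_ge0.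
have mE := iint_mpos s' mg.
rewrite (_ : int01 _ = int01 (fun t => (q%:R^-1 ^+ count [in B] s *
    box eta (B :\: [set a in s]) (upd k a t))%:E * iint s' g (upd k a t))%E); last first.
  by apply: int01_eq => t _; exact: IH.
have setE : B :\: [set b in a :: s] = (B :\: [set b in s]) :\ a.
  by apply/setP => i; rewrite !inE negb_or -andbA andbCA.
have box0 S y : (0 <= (box eta S y)%:E)%E by rewrite lee_fin; case/andP: (box_ge0_le1 eta S y).
rewrite setE; case: (boolP (a \in B)) => aB /=.
  have aBs : a \in B :\: [set b in s] by rewrite !inE as'.
  have indE : indep (enum B) (iint s' g) by exact: indep_iint.
  transitivity (int01 (fun t => ((q%:R^-1 ^+ count [in B] s *
      box eta (B :\: [set b in s] :\ a) k)%:E * iint s' g k) * (chi q (eta a) t)%:E)%E).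
    apply: int01_eq => t _; rewrite box_upd_in// indE ?mem_enum//.
    by rewrite muleAC -EFinM mulrCA [in RHS]mulrC.
  rewrite int01Zl.
  - rewrite int01_chi muleAC -EFinM; congr (_ * _)%E; congr EFin.
    by rewrite add1n exprS mulrC mulrA.
  - by apply/measurable_EFinP; apply: measurable_chi.
  - by move=> t _; rewrite lee_fin chi_ge0.
  - by rewrite EFinM !mule_ge0//; exact: mE.2.
have BE : B :\: [set b in s] :\ a = B :\: [set b in s].
  apply/setP => i; rewrite !inE; case: eqP => //= ->.
  by rewrite (negbTE aB) andbF.
rewrite BE add0n -int01Zl.
- by apply: int01_eq => t _; rewrite box_upd_out// !inE (negbTE aB) andbF.
- exact: mpos_upd.
- by move=> t _; exact: mE.2.
- by rewrite EFinM mule_ge0.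
Qed.

Definition agree eta zeta S := [forall (i | i \in S), eta i == zeta i].

(** The coordinates in [S] are not integrated, so the full indicator inside already tests them at
    [k], and testing twice changes nothing. *)
Lemma boxM_absorb zeta S (f : T -> \bar R) A k : mpos f -> cube k -> S \subset ~: A ->
  ((box zeta S k)%:E * iset A (fun z => (box zeta [set: _]%SET z)%:E * f z) k)%E =
  iset A (fun z => (box zeta [set: _]%SET z)%:E * f z)%E k.
Proof.
move=> mf ck SA; rewrite /iset -(@iint_Zl _ _ _ (fun y => (box zeta S y)%:E)).
- apply: (@iint_eq _ _ (@cube R N)) => // [y a t _ cy t01|y cy]; first exact: cube_upd.
  rewrite muleA -EFinM boxTE// boxE//; case: (zeta =P cell y) => [->|_]; last by rewrite mulr0.
  by rewrite (_ : [forall (i | _), _]) ?mulr1//; apply/forall_inP.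
- exact: mpos_box.
- by apply: mposM => //; exact: mpos_box.
- move=> y a t; rewrite mem_enum => aA; rewrite box_upd_out//.
  by apply/negP => /(fintype.subsetP SA); rewrite inE aA.
Qed.

(** Weight of the passage from cell [kappa] through [eta] to [zeta]: averaging over [A] moves only
    coordinates in [A], averaging over [B] only those in [B], and in a direction moved twice the
    intermediate coordinate ranges over an interval of length [1/q]. *)
Definition weight eta zeta kappa A B : R :=
  (agree eta zeta (~: B) && agree eta kappa (~: A))%:R * q%:R^-1 ^+ #|A :&: B|.

Lemma iset_box_iset eta zeta A B (v : T -> \bar R) k : mpos v -> cube k ->
  iset A (fun y => (box eta [set: _]%SET y)%:E * iset B (fun z => (box zeta [set: _]%SET z)%:E * v z) y)%E k =
  ((weight eta zeta (cell k) A B)%:E *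
   iset (A :|: B) (fun z => (box zeta [set: _]%SET z)%:E * v z) k)%E.
Proof.
move=> mv ck; set w := fun z : T => ((box zeta [set: _]%SET z)%:E * v z)%E.
have mw : mpos w by apply: mposM => //; exact: mpos_box.
have cube_stable (y : T) a t (s : seq 'I_N) : a \in s -> cube y -> in01 t -> cube (upd y a t).
  by move=> _; exact: cube_upd.
(* Off [B] the inner average leaves the coordinates of [y] in place, so a disagreement of [eta] and
   [zeta] there makes the integrand vanish. *)
rewrite /weight; case: (boolP (agree eta zeta (~: B))) => ez /=; last first.
  rewrite mul0r mul0e -(@iint_cst R _ (enum A) 0 k).
  apply: (@iint_eq _ _ (@cube R N)) => // [y a t _ cy t01|y cy]; first exact: cube_upd.
  rewrite -(@boxM_absorb zeta (~: B) v B y)// muleA -EFinM.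
  rewrite boxTE// boxE//; case: eqP => [e|_]; last by rewrite mul0r mul0e.
  have ze : agree zeta eta (~: B) = false.
    by apply: contraNF ez => /forall_inP h; apply/forall_inP => i /h; rewrite eq_sym.
  by rewrite -e -/(agree zeta eta (~: B)) ze mulr0 mul0e.
(* Off [B] the two cells now agree, and the inner indicator tests those coordinates; only the
   factors of [box eta] over [B] are kept, next to a function independent of [B]. *)
transitivity (iset A (fun y => (box eta B y)%:E * iset B w y)%E k).
  apply: (@iint_eq _ _ (@cube R N)) => // [y a t _ cy t01|y cy]; first exact: cube_upd.
  rewrite -[in RHS](@boxM_absorb zeta (~: B) v B y)// [RHS]muleA -EFinM.
  congr (_%:E * _)%E; rewrite !boxE// -natrM mulnb; congr (_ %:R); congr nat_of_bool.
  apply/forall_inP/andP => [h|[/forall_inP h1 /forall_inP h2] i _].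
    split; apply/forall_inP => i iB; first exact: h.
    by rewrite -(eqP (forall_inP ez i iB)); exact: h.
  case: (boolP (i \in B)) => iB; first exact: h1.
  have iB' : i \in ~: B by rewrite inE.
  by rewrite (eqP (forall_inP ez i iB')); exact: h2.
rewrite [LHS]iint_box ?enum_uniq//; [|exact: indep_self|exact: iint_mpos].
have -> : iint [seq a <- enum A | a \notin B] (iset B w) k = iset (A :|: B) w k.
  rewrite -iset_iset// /iset -!iint_cat [RHS]iint_absorb; congr (iint (_ ++ _) _ _).
  by apply: eq_filter => i; rewrite mem_enum.
(* The factors left from [eta] test [k] on [B] minus [A], and [zeta], which agrees with [eta] off
   [B], tests it off the union. Together they express the agreement of [eta] with the cell of [k]
   off [A]. *)
rewrite -[in LHS](@boxM_absorb zeta (~: (A :|: B)) v (A :|: B) k)// muleA -EFinM.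
congr (_%:E * _)%E.
have -> : count [in B] (enum A) = #|A :&: B|.
  rewrite cardE -size_filter; congr size; rewrite /enum_mem -filter_predI.
  by apply: eq_filter => i; rewrite !inE /= andbC.
rewrite [RHS]mulrC -mulrA; congr (_ * _).
rewrite !boxE// -!natrM !mulnb; congr (_ %:R); congr nat_of_bool.
apply/andP/forall_inP => [[/forall_inP h1 /forall_inP h2] i|h].
  rewrite inE => hi; case: (boolP (i \in B)) => iB.
    by apply: h1; rewrite !inE mem_enum hi.
  have iB' : i \in ~: B by rewrite inE.
  by rewrite (eqP (forall_inP ez i iB')); apply: h2; rewrite !inE negb_or hi.
split; apply/forall_inP => i; rewrite !inE ?mem_enum ?negb_or => /andP[hA hB].
  by apply: h; rewrite inE.
have iB' : i \in ~: B by rewrite inE.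
by rewrite -(eqP (forall_inP ez i iB')); apply: h; rewrite inE.
Qed.

End Compose.
End Cells.

Section ComplexAbs.
Context {R : realType}.
Local Notation C := R[i].
Implicit Types (z : C).

Lemma cabs_ge0 z : 0 <= cabs z.
Proof. by case: z => a b; rewrite /cabs /= sqrtr_ge0. Qed.

Lemma cabs0 : cabs (0 : C) = 0. Proof. exact: Normc.normc0. Qed.

Lemma cabs_eq0 z : cabs z = 0 -> z = 0. Proof. exact: Normc.eq0_normc. Qed.

Lemma cabsM z1 z2 : cabs (z1 * z2) = cabs z1 * cabs z2. Proof. exact: Normc.normcM. Qed.

Lemma cabsD z1 z2 : cabs (z1 + z2) <= cabs z1 + cabs z2. Proof. exact: le_normcD. Qed.

Lemma cabs_sum (I : Type) (r : seq I) (P : pred I) (F : I -> C) :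
  cabs (\sum_(i <- r | P i) F i) <= \sum_(i <- r | P i) cabs (F i).
Proof.
elim/big_ind2 : _ => //; first by rewrite cabs0.
by move=> x1 x2 z1 z2 h1 h2; apply: le_trans (cabsD _ _) _; exact: lerD.
Qed.

Lemma sqr_cabs z : cabs z ^+ 2 = complex.Re z ^+ 2 + complex.Im z ^+ 2.
Proof. by case: z => a b; rewrite /cabs /= sqr_sqrtr// addr_ge0// sqr_ge0. Qed.

Lemma abs_Re_le z : `|complex.Re z| <= cabs z.
Proof.
rewrite -(@ler_pXn2r _ 2)// ?nnegrE ?cabs_ge0// sqr_cabs.
by rewrite real_normK ?num_real// lerDl sqr_ge0.
Qed.

Lemma abs_Im_le z : `|complex.Im z| <= cabs z.
Proof.
rewrite -(@ler_pXn2r _ 2)// ?nnegrE ?cabs_ge0// sqr_cabs.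
by rewrite real_normK ?num_real// lerDr sqr_ge0.
Qed.

Lemma cabs_le_ReIm z : cabs z <= `|complex.Re z| + `|complex.Im z|.
Proof.
rewrite -(@ler_pXn2r _ 2)// ?nnegrE ?cabs_ge0 ?addr_ge0// sqr_cabs sqrrD.
by rewrite !real_normK ?num_real// -addrA lerD2l lerDr mulrn_wge0// mulr_ge0.
Qed.

End ComplexAbs.

(** * Coefficients and the norm *)

Section Coefficients.
Local Open Scope classical_set_scope.
Context {R : realType}.
Variables N M p : nat.
Hypotheses (M0 : (0 < M)%N) (p0 : (0 < p)%N).
Local Notation C := R[i].
Local Notation cells := {ffun 'I_N -> 'I_p}.
Local Notation T := (N.-tuple R).
Implicit Types (A B : coefs R N M) (k y : T) (alpha : {set 'I_N}).

Definition restr alpha y : #|alpha|.-tuple R := [tuple tnth y (enum_val i) | i < #|alpha|].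

Lemma tnth_mergeL_in alpha k (x : #|alpha|.-tuple R) (i : 'I_#|alpha|) :
  tnth (mergeL alpha k x) (enum_val i) = tnth x i.
Proof.
rewrite tnth_mktuple enum_valP (tnth_nth 0); congr nth.
rewrite (enum_val_nth (enum_val i)) index_uniq ?enum_uniq// -cardE//.
Qed.

Lemma tnth_mergeL_out alpha k (x : #|alpha|.-tuple R) i : i \notin alpha ->
  tnth (mergeL alpha k x) i = tnth k i.
Proof. by move=> ia; rewrite tnth_mktuple (negbTE ia). Qed.

Variant mem_spec alpha (i : 'I_N) : Type :=
  | MemIn (j : 'I_#|alpha|) of i = enum_val j
  | MemOut of i \notin alpha.

Lemma memP alpha i : mem_spec alpha i.
Proof.
case: (boolP (i \in alpha)) => ia; last exact: MemOut.
by apply: (@MemIn _ _ (enum_rank_in ia i)); rewrite enum_rankK_in.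
Qed.

Lemma cube_restr alpha y : cube y -> cube (restr alpha y).
Proof. by move=> cy i; rewrite tnth_mktuple. Qed.

Lemma restr_mergeL alpha k (x : #|alpha|.-tuple R) : restr alpha (mergeL alpha k x) = x.
Proof. by apply: eq_from_tnth => i; rewrite tnth_mktuple tnth_mergeL_in. Qed.

Lemma restr_corner alpha y :
  restr alpha (corner (cell p0 y)) = corner (cell p0 (restr alpha y)).
Proof. by apply: eq_from_tnth => i; rewrite !tnth_mktuple !ffunE tnth_mktuple. Qed.

Lemma corner_mergeL alpha k (x : #|alpha|.-tuple R) :
  mergeL (R := R) alpha (corner (cell p0 k)) (corner (cell p0 x)) = corner (cell p0 (mergeL alpha k x)).
Proof.
apply: eq_from_tnth => i; case: (memP alpha i) => [j ->|ia].
  by rewrite tnth_mergeL_in !tnth_mktuple !ffunE tnth_mergeL_in.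
by rewrite tnth_mergeL_out// !tnth_mktuple !ffunE tnth_mergeL_out.
Qed.

(* The coefficients of an operator given by its values on pairs of cells of the
   grid; [A alpha k x] is read off the cells of [k] and of the merged point. *)
Definition cellval := {set 'I_N} -> cells -> cells -> 'M[C]_M.

Definition given_by A (G : cellval) := forall alpha k (x : #|alpha|.-tuple R),
  cube k -> cube x -> A alpha k x = G alpha (cell p0 k) (cell p0 (mergeL alpha k x)).

Definition cells_of A : cellval := fun alpha kappa eta =>
  A alpha (corner kappa) (restr alpha (corner eta)).

Definition coefs_of (G : cellval) : coefs R N M := fun alpha k x =>
  G alpha (cell p0 k) (cell p0 (mergeL alpha k x)).

Lemma given_by_cells A : is_stair p A -> given_by A (cells_of A).
Proof.
move=> sA alpha k x ck cx; apply/matrixP => i j.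
have /(staircaseP p0) -> // := sA alpha i j.
by rewrite /cells_of restr_corner restr_mergeL.
Qed.

Lemma coefs_ofP G : given_by (coefs_of G) G.
Proof. by []. Qed.

Lemma stair_coefs_of G : is_stair p (coefs_of G).
Proof.
move=> alpha i j; apply/(staircaseP p0) => k y ck cy.
by rewrite /coefs_of corner_mergeL !cornerK.
Qed.

Lemma staircase_lin n m (f g : n.-tuple R -> m.-tuple R -> C) (c : C) :
  staircase p f -> staircase p g -> staircase p (fun z1 z2 => c * f z1 z2 + g z1 z2).
Proof.
move=> /(staircaseP p0) hf /(staircaseP p0) hg; apply/(staircaseP p0) => k y ck cy.
by rewrite hf// hg.
Qed.

Lemma staircase_ext n m (f g : n.-tuple R -> m.-tuple R -> C) :
  (forall z1 z2, f z1 z2 = g z1 z2) -> staircase p f -> staircase p g.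
Proof. by move=> fg; have -> : f = g by apply/funext => k; apply/funext => x. Qed.

Lemma stair_sub A B : is_stair p A -> is_stair p B -> is_stair p (subL A B).
Proof.
move=> sA sB alpha i j; apply: staircase_ext (staircase_lin (-1) (sB alpha i j) (sA alpha i j)).
by move=> k x; rewrite !mxE mulN1r addrC.
Qed.

Lemma stair_scale c A : is_stair p A -> is_stair p (scaleL c A).
Proof.
move=> sA alpha i j; apply/(staircaseP p0) => k y ck cy.
by have /(staircaseP p0) h := sA alpha i j; rewrite /scaleL !mxE h.
Qed.

Definition rowset A alpha : set R := [set r : R |
  exists (k : T) (x : #|alpha|.-tuple R) (i : 'I_M),
    [/\ cube k, cube x & r = \sum_(j < M) cabs (A alpha k x i j)]].

Definition rownorm A alpha : R := sup (rowset A alpha).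

Lemma rownorm_le A alpha c :
  (forall k (x : #|alpha|.-tuple R) i, cube k -> cube x ->
     \sum_(j < M) cabs (A alpha k x i j) <= c) -> rownorm A alpha <= c.
Proof.
move=> h; apply: ge_sup; last by move=> _ [k [x [i [ck cx ->]]]]; exact: h.
(* The bound on [sup] requires a nonempty set: zero tuples lie in the cubes and [M0] provides a
   row. *)
pose z := fun n : nat => [tuple of nseq n (0 : R)].
have cz n : cube (z n) by move=> i; rewrite (tnth_nth 0) nth_nseq; case: ifP; rewrite /in01 lexx ltr01.
by eexists; exists (z N), (z _), (Ordinal M0); split.
Qed.

Lemma row_le_rownorm A alpha k (x : #|alpha|.-tuple R) i : is_stair p A ->
  cube k -> cube x -> \sum_(j < M) cabs (A alpha k x i j) <= rownorm A alpha.
Proof.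
move=> sA ck cx; apply: ub_le_sup; last by exists k, x, i.
(* There are finitely many values, so the sum of all moduli over all pairs of cells is an upper
   bound. *)
exists (\sum_(kappa : cells) \sum_(eta : cells) \sum_(i < M) \sum_(j < M)
   cabs (cells_of A alpha kappa eta i j)) => _ [k' [x' [i' [ck' cx' ->]]]].
rewrite (given_by_cells sA)//.
have one (I : finType) (F : I -> R) (l : I) : (forall l', 0 <= F l') -> F l <= \sum_l' F l'.
  by move=> F0; rewrite (bigD1 l)//= lerDl sumr_ge0.
have row0 kappa eta i1 : 0 <= \sum_(j < M) cabs (cells_of A alpha kappa eta i1 j).
  by apply: sumr_ge0 => j _; exact: cabs_ge0.
apply: le_trans (one _ _ (cell p0 k') _); last first.
  by move=> kappa; apply: sumr_ge0 => eta _; apply: sumr_ge0.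
apply: le_trans (one _ _ (cell p0 (mergeL alpha k' x')) _); last first.
  by move=> eta; apply: sumr_ge0.
by apply: le_trans (one _ _ i' _).
Qed.

Lemma rownorm_ge0 A alpha : 0 <= rownorm A alpha.
Proof.
(* By convention [sup] is 0 on a set without supremum, which settles families that are not
   staircase. *)
rewrite /rownorm; have [[ne [b ub]]|/sup_out->//] := pselect (has_sup (rowset A alpha)).
have [r rS] := ne; apply: le_trans (ub_le_sup _ rS); last by exists b.
by case: rS => k [x [i [_ _ ->]]]; apply: sumr_ge0 => *; exact: cabs_ge0.
Qed.

Lemma normLE A : normL A = \sum_(alpha : {set 'I_N}) rownorm A alpha.
Proof. by []. Qed.

Lemma normL_ge0 A : 0 <= normL A.
Proof. by rewrite normLE; apply: sumr_ge0 => *; exact: rownorm_ge0. Qed.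

Lemma rownorm_le_normL A alpha : rownorm A alpha <= normL A.
Proof.
rewrite normLE (bigD1 alpha)//= lerDl.
by apply: sumr_ge0 => *; exact: rownorm_ge0.
Qed.

Lemma cabs_le_row A alpha k (x : #|alpha|.-tuple R) i j :
  cabs (A alpha k x i j) <= \sum_(j < M) cabs (A alpha k x i j).
Proof. by rewrite (bigD1 j)//= lerDl; apply: sumr_ge0 => *; exact: cabs_ge0. Qed.

Lemma normL_eq A B :
  (forall alpha k (x : #|alpha|.-tuple R), cube k -> cube x -> A alpha k x = B alpha k x) ->
  normL A = normL B.
Proof.
move=> AB; rewrite !normLE; apply: eq_bigr => alpha _; congr sup.
apply/seteqP; split => _ [k [x [i [ck cx ->]]]]; exists k, x, i; split => //;
by rewrite AB.
Qed.

Lemma normL_scale c A : is_stair p A -> normL (scaleL c A) = cabs c * normL A.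
Proof.
move=> sA; rewrite !normLE mulr_sumr; apply: eq_bigr => alpha _.
have le d B : is_stair p B -> rownorm (scaleL d B) alpha <= cabs d * rownorm B alpha.
  move=> sB; apply: rownorm_le => k x i ck cx.
  rewrite (eq_bigr (fun j => cabs d * cabs (B alpha k x i j))); last first.
    by move=> j _; rewrite mxE cabsM.
  by rewrite -mulr_sumr ler_wpM2l ?cabs_ge0 ?row_le_rownorm.
apply/eqP; rewrite eq_le le//=.
have [->|c0] := eqVneq c 0; first by rewrite cabs0 mul0r rownorm_ge0.
have cc : 0 < cabs c.
  by rewrite lt0r cabs_ge0 andbT; apply: contra_neq c0; exact: cabs_eq0.
(* The reverse inequality is the direct one for the factor [c^-1] and the family [scaleL c A]. *)
have := le c^-1 _ (stair_scale c sA).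
have -> : rownorm (scaleL c^-1 (scaleL c A)) alpha = rownorm A alpha.
  congr sup; apply/seteqP; split => _ [k [x [i [ck cx ->]]]]; exists k, x, i; split => //;
  by rewrite /scaleL scalerA mulVf// scale1r.
move=> h; rewrite mulrC -ler_pdivlMr//; apply: le_trans h _.
by rewrite mulrC ler_wpM2l ?rownorm_ge0// /cabs Normc.normcV.
Qed.

Lemma normL_add A B : is_stair p A -> is_stair p B ->
  normL (addL A B) <= normL A + normL B.
Proof.
move=> sA sB; rewrite !normLE -big_split; apply: ler_sum => alpha _.
apply: rownorm_le => k x i ck cx.
apply: (@le_trans _ _ (\sum_(j < M) (cabs (A alpha k x i j) + cabs (B alpha k x i j)))).
  by apply: ler_sum => j _; rewrite mxE cabsD.
by rewrite big_split lerD// row_le_rownorm.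
Qed.

Lemma normL_cvgP (A : nat -> coefs R N M) B :
  (forall n, is_stair p (A n)) -> is_stair p B ->
  (forall e : R, 0 < e -> exists n0, forall n, (n0 <= n)%N -> normL (subL (A n) B) < e)
  <->
  (forall alpha (i j : 'I_M) (e : R), 0 < e ->
     exists n0, forall n, (n0 <= n)%N ->
       forall k (x : #|alpha|.-tuple R), cube k -> cube x ->
         cabs (A n alpha k x i j - B alpha k x i j) < e).
Proof.
move=> sA sB; split=> [h alpha i j e e0|h e e0].
  have [n0 hn] := h e e0; exists n0 => n /hn ln k x ck cx.
  apply: le_lt_trans ln; apply: le_trans (rownorm_le_normL _ alpha).
  apply: le_trans (row_le_rownorm i (stair_sub (sA n) sB) ck cx).
  by have := cabs_le_row (subL (A n) B) k x i j; rewrite !mxE.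
(* If all entries are below [d], the norm is at most the number of index sets times [M] times [d],
   that is [e / 2]; the halving restores the strict inequality lost in the suprema. *)
pose d := e / 2 / (#|{set 'I_N}|%:R * M%:R).
have K0 : (0 : R) < #|{set 'I_N}|%:R * M%:R.
  rewrite mulr_gt0 ?ltr0n//; apply/card_gt0P; by exists finset.set0.
have d0 : 0 < d by rewrite divr_gt0// divr_gt0.
have /choice [f hf] : forall z : {set 'I_N} * 'I_M * 'I_M, exists n0, forall n, (n0 <= n)%N ->
    forall k (x : #|z.1.1|.-tuple R), cube k -> cube x ->
      cabs (A n z.1.1 k x z.1.2 z.2 - B z.1.1 k x z.1.2 z.2) < d.
  by move=> [[alpha i] j]; exact: h.
exists (\max_z f z)%N => n hn.
have hle : normL (subL (A n) B) <= \sum_(alpha : {set 'I_N}) d * M%:R.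
  rewrite normLE; apply: ler_sum => alpha _; apply: rownorm_le => k x i ck cx.
  rewrite mulr_natr -[leRHS](_ : \sum_(j < M) d = _); last by rewrite sumr_const card_ord.
  apply: ler_sum => j _; rewrite !mxE ltW//.
  apply: (hf (alpha, i, j)) => //; apply: leq_trans hn.
  exact: (@leq_bigmax _ f (alpha, i, j)).
apply: le_lt_trans hle _; rewrite sumr_const -[ltLHS]mulr_natr -mulrA [M%:R * _]mulrC.
rewrite /d divfK ?gt_eqF// gtr_pMr// invf_lt1// ltr1n//.
Qed.

(** The supremum of the eventual lower bounds is the lower limit. Beyond [n0], [u n - e] is an
    eventual lower bound and [u n + e] exceeds all of them, so the limit inherits the Cauchy
    estimate with the same [e] and [n0]. *)
Lemma cauchy_sup_lim (u : nat -> R) :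
  forall e n0, (forall m n, (n0 <= m)%N -> (n0 <= n)%N -> `|u m - u n| <= e) ->
  forall n, (n0 <= n)%N ->
  `|sup [set x | exists n1, forall m, (n1 <= m)%N -> x <= u m] - u n| <= e.
Proof.
move=> e n0 h n hn; set S := [set x | _].
have inS : S (u n - e).
  by exists n0 => m hm; rewrite lerBlDr; have := h _ _ hn hm; rewrite ler_norml => /andP[_]; rewrite lerBlDr addrC.
have ubS : ubound S (u n + e).
  move=> x [n1 hx]; apply: le_trans (hx (maxn n0 n1) (leq_maxr _ _)) _.
  have := h (maxn n0 n1) n (leq_maxl _ _) hn.
  by rewrite ler_norml => /andP[_]; rewrite lerBlDr addrC.
rewrite ler_norml; apply/andP; split.
  by rewrite lerBrDl; apply: ub_le_sup inS; exists (u n + e).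
by rewrite lerBlDl; apply: ge_sup ubS; exists (u n - e).
Qed.

(** The limit is taken separately for each pair of cells and reassembled, so it is staircase by
    construction. *)
Lemma normL_complete (A : nat -> coefs R N M) : (forall n, is_stair p (A n)) ->
  (forall e : R, 0 < e -> exists n0, forall m n, (n0 <= m)%N -> (n0 <= n)%N ->
     normL (subL (A m) (A n)) < e) ->
  exists B : coefs R N M, is_stair p B /\
    (forall e : R, 0 < e -> exists n0, forall n, (n0 <= n)%N -> normL (subL (A n) B) < e).
Proof.
move=> sA cA.
pose lim (u : nat -> R) := sup [set x | exists n1, forall m, (n1 <= m)%N -> x <= u m].
pose G : cellval := fun alpha kappa eta => \matrix_(i, j) Complex
  (lim (fun n => complex.Re (cells_of (A n) alpha kappa eta i j)))
  (lim (fun n => complex.Im (cells_of (A n) alpha kappa eta i j))).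
exists (coefs_of G); split; first exact: stair_coefs_of.
apply/normL_cvgP => //; first exact: stair_coefs_of.
move=> alpha i j e e0.
(* Real and imaginary parts each err by at most [e / 3], which leaves the sum strictly below [e]. *)
have e30 : 0 < e / 3 by rewrite divr_gt0.
have [n0 hn0] := cA _ e30; exists n0 => n hn k x ck cx.
rewrite (given_by_cells (sA n))// /coefs_of mxE.
set kappa := cell _ k; set eta := cell _ _.
have H m1 m2 : (n0 <= m1)%N -> (n0 <= m2)%N ->
   cabs (cells_of (A m1) alpha kappa eta i j - cells_of (A m2) alpha kappa eta i j) <= e / 3.
  move=> h1 h2; apply: le_trans (ltW (hn0 _ _ h1 h2)).
  apply: le_trans (rownorm_le_normL _ alpha).
  apply: le_trans (row_le_rownorm i (stair_sub (sA m1) (sA m2)) ck cx).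
  have := cabs_le_row (subL (A m1) (A m2)) k x i j.
  by rewrite /subL !(given_by_cells (sA _))// !mxE.
have ReB (z w : C) : complex.Re z - complex.Re w = complex.Re (z - w) by case: z; case: w.
have ImB (z w : C) : complex.Im z - complex.Im w = complex.Im (z - w) by case: z; case: w.
apply: le_lt_trans (cabs_le_ReIm _) _; rewrite -ReB -ImB /=.
apply: (@le_lt_trans _ _ (e / 3 + e / 3)); last first.
  by lra.
rewrite -[`|_ - lim _|]normrN -[X in _ + X]normrN !opprB.
apply: lerD; apply: (@cauchy_sup_lim (fun n => _)) hn => // m1 m2 h1 h2.
- by rewrite ReB; apply: le_trans (abs_Re_le _) _; exact: H.
- by rewrite ImB; apply: le_trans (abs_Im_le _) _; exact: H.
Qed.

End Coefficients.

(** * Boundedness on L^2 *)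

Section Action.
Local Open Scope classical_set_scope.
Context {R : realType}.
Variables N M p : nat.
Hypotheses (M0 : (0 < M)%N) (p0 : (0 < p)%N).
Local Notation C := R[i].
Local Notation cells := {ffun 'I_N -> 'I_p}.
Local Notation T := (N.-tuple R).
Implicit Types (A B : coefs R N M) (G : @cellval R N M p) (k y : T) (alpha : {set 'I_N})
  (u v : vfun R N M).

Definition ciint (s : seq 'I_N) (F : T -> C) k : C :=
  Complex (riint s (fun y => complex.Re (F y)) k) (riint s (fun y => complex.Im (F y)) k).

Lemma ciint_eq_cube s (F F' : T -> C) k : (forall y, cube y -> F y = F' y) -> cube k ->
  ciint s F k = ciint s F' k.
Proof. by move=> h ck; congr Complex; apply: riint_eq_cube => // y /h ->. Qed.

(** On the cube a coefficient depends on the integrated point only through its cell, so the action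
    becomes a sum of averages of functions of a full point. *)
Lemma actLE A G u k i : given_by p0 A G -> cube k ->
  actL A u k i = \sum_(alpha : {set 'I_N}) ciint (enum alpha)
    (fun y => \sum_(j < M) G alpha (cell p0 k) (cell p0 y) i j * u y j) k.
Proof.
move=> AG ck; apply: eq_bigr => alpha _.
rewrite /cint /ciint -!rint_mergeL; congr Complex; apply: rint_eq => x cx.
  by congr complex.Re; apply: eq_bigr => j _; rewrite AG.
by congr complex.Im; apply: eq_bigr => j _; rewrite AG.
Qed.

Lemma sume_cst (I : finType) (x : \bar R) : (0 <= x)%E ->
  (\sum_(i : I) x = #|I|%:R%:E * x)%E.
Proof.
move=> x0; transitivity (\sum_(i : I) 1%:E * x)%E.
  by apply: eq_bigr => i _; rewrite mul1e.
by rewrite -ge0_sume_distrl// sumEFin sumr_const.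
Qed.

Definition origin : T := [tuple of nseq N 0].

Lemma cube_origin : cube origin.
Proof. by move=> i; rewrite (tnth_nth 0) nth_nseq; case: ifP; rewrite /in01 lexx ltr01. Qed.

Definition sqn u k : R := \sum_(j < M) cabs (u k j) ^+ 2.

Lemma sqn_ge0 u k : 0 <= sqn u k.
Proof. by apply: sumr_ge0 => j _; exact: sqr_ge0. Qed.

Lemma l2sqE u k : l2sq u = iset [set: _]%SET (fun y => (sqn u y)%:E) k.
Proof. exact: eint_iset. Qed.

Lemma iset_cube_le alpha (f g : T -> \bar R) k : cube k ->
  (forall y, cube y -> (0 <= f y <= g y)%E) -> (iset alpha f k <= iset alpha g k)%E.
Proof.
move=> ck fg; suff /andP[//] : (0 <= iset alpha f k <= iset alpha g k)%E.
by apply: (@iint_le _ _ (@cube R N)) => // y a t _; exact: cube_upd.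
Qed.

Lemma iset_cube_eq alpha (f g : T -> \bar R) k : cube k ->
  (forall y, cube y -> f y = g y) -> iset alpha f k = iset alpha g k.
Proof.
by move=> ck fg; apply: (@iint_eq _ _ (@cube R N)) => // y a t _; exact: cube_upd.
Qed.

Lemma l2sq_eq u v : (forall k i, cube k -> u k i = v k i) -> l2sq u = l2sq v.
Proof.
move=> uv; rewrite !(l2sqE _ origin); apply: iset_cube_eq; first exact: cube_origin.
by move=> y cy; congr EFin; apply: eq_bigr => j _; rewrite uv.
Qed.

Lemma l2sq_ge0 u : (0 <= l2sq u)%E.
Proof. by rewrite (l2sqE u origin); apply: iint_ge0 => y; rewrite lee_fin sqn_ge0. Qed.

Lemma mpos_sqn u : isL2 u -> mpos (fun k => (sqn u k)%:E).
Proof.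
move=> [mu _]; split; last by move=> y; rewrite lee_fin sqn_ge0.
apply/measurable_EFinP; apply: measurable_sum => j.
under eq_fun do rewrite sqr_cabs.
by have [mr mi] := mu j; apply: measurable_funD; exact: measurable_funX.
Qed.

Section Bound.
Variables (A : coefs R N M) (u : vfun R N M).
Hypotheses (sA : is_stair p A) (u2 : isL2 u).
Let L := normL A.
Let K : R := #|{set 'I_N}|%:R.
Let Q (k : T) := (sqn u k)%:E.
Let S (k : T) := (\sum_(alpha : {set 'I_N}) iset alpha Q k)%E.

Lemma cabs_cells_le alpha (kappa eta : cells) i j : cabs (cells_of A alpha kappa eta i j) <= L.
Proof.
rewrite /cells_of; apply: le_trans (cabs_le_row _ _ _ _ _) _.
apply: le_trans (rownorm_le_normL _ alpha).
apply: (row_le_rownorm p0) => //; [exact: cube_corner|apply: cube_restr; exact: cube_corner].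
Qed.

Lemma cabs_actL_le (l : R) k i : 0 < l -> cube k ->
  ((cabs (actL A u k i))%:E <= (L / l)%:E * (S k + (K * M%:R * l ^+ 2)%:E))%E.
Proof.
move=> l0 ck; have L0 : 0 <= L by exact: normL_ge0.
rewrite (actLE u i (given_by_cells p0 sA) ck).
pose F alpha y := \sum_(j < M) cells_of A alpha (cell p0 k) (cell p0 y) i j * u y j.
(* The factor comes from [2 l |u_j| <= |u_j|^2 + l^2]; the bounds for the real and imaginary parts
   add up to [c + c = L / l]. *)
pose c := L / (2 * l).
have c0 : 0 <= c by rewrite divr_ge0// mulr_ge0// ltW.
have Fle alpha y : cabs (F alpha y) <= c * (sqn u y + M%:R * l ^+ 2).
  apply: (@le_trans _ _ (\sum_(j < M) L * cabs (u y j))).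
    apply: le_trans (cabs_sum _ _ _) _; apply: ler_sum => j _.
    by rewrite cabsM ler_wpM2r ?cabs_ge0// cabs_cells_le.
  rewrite -mulr_sumr /c -mulrA ler_wpM2l// mulrC ler_pdivlMr ?mulr_gt0//.
  have -> : M%:R * l ^+ 2 = \sum_(j < M) l ^+ 2.
    by rewrite sumr_const card_ord mulr_natl.
  rewrite -big_split mulr_suml; apply: ler_sum => j _ /=.
  have := sqr_ge0 (cabs (u y j) - l); set a := cabs _; nra.
have mQ : mpos Q by exact: mpos_sqn.
have cEle alpha : ((cabs (ciint (enum alpha) (F alpha) k))%:E <=
    (L / l)%:E * (iset alpha Q k + (M%:R * l ^+ 2)%:E))%E.
  have Ele (f : T -> R) : (forall y, `|f y| <= cabs (F alpha y)) ->
      (`|riint (enum alpha) f k|%:E <= c%:E * (iset alpha Q k + (M%:R * l ^+ 2)%:E))%E.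
    move=> fF.
    have -> : (c%:E * (iset alpha Q k + (M%:R * l ^+ 2)%:E))%E =
        iint (enum alpha) (fun y => c%:E * (Q y + (M%:R * l ^+ 2)%:E))%E k.
      have mc : mpos (fun _ : T => (M%:R * l ^+ 2)%:E).
        by apply: mpos_cst; rewrite lee_fin mulr_ge0// sqr_ge0.
      have mc' : mpos (fun _ : T => c%:E) by apply: mpos_cst; rewrite lee_fin.
      have mD : mpos (fun y => Q y + (M%:R * l ^+ 2)%:E)%E by exact: mposD.
      by rewrite (@iint_Zl _ _ _ (fun=> c%:E) _ _ mc' mD)// iint_D// iint_cst.
    apply: abs_riint_le => // y cy; rewrite lee_fin; apply: le_trans (fF y) _.
    exact: Fle.
  apply: (@le_trans _ _ (c%:E * (iset alpha Q k + (M%:R * l ^+ 2)%:E) +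
     c%:E * (iset alpha Q k + (M%:R * l ^+ 2)%:E))%E).
    apply: (@le_trans _ _ (`|riint (enum alpha) (fun y => complex.Re (F alpha y)) k|%:E +
       `|riint (enum alpha) (fun y => complex.Im (F alpha y)) k|%:E)%E).
      by rewrite -EFinD lee_fin; exact: cabs_le_ReIm.
    by apply: leeD; apply: Ele => y; [exact: abs_Re_le|exact: abs_Im_le].
  rewrite -ge0_muleDl ?lee_fin// -EFinD (_ : c + c = L / l)//.
  by rewrite /c; field; exact: lt0r_neq0.
apply: (@le_trans _ _ (\sum_(alpha : {set 'I_N}) (cabs (ciint (enum alpha) (F alpha) k))%:E)%E).
  by rewrite sumEFin lee_fin; exact: cabs_sum.
apply: (@le_trans _ _ (\sum_(alpha : {set 'I_N})
    (L / l)%:E * (iset alpha Q k + (M%:R * l ^+ 2)%:E))%E).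
  by apply: lee_sum => alpha _; exact: cEle.
have Q0 alpha : (0 <= iset alpha Q k)%E by apply: iint_ge0; exact: mQ.2.
rewrite -ge0_sume_distrr; last first.
  by move=> alpha _; rewrite adde_ge0// lee_fin mulr_ge0// sqr_ge0.
rewrite big_split /= sumEFin (_ : \sum_(_ : _) _ = K * M%:R * l ^+ 2)//.
by rewrite sumr_const -mulrA -[LHS]mulr_natl.
Qed.

Lemma sqr_actL_le k i : cube k ->
  ((cabs (actL A u k i) ^+ 2)%:E <= (4 * L ^+ 2 * K * M%:R)%:E * S k)%E.
Proof.
move=> ck; have L0 : 0 <= L by exact: normL_ge0.
have mQ : mpos Q by exact: mpos_sqn.
have S0 : (0 <= S k)%E by apply: sume_ge0 => alpha _; apply: iint_ge0; exact: mQ.2.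
have K0 : 0 < K by rewrite ltr0n; apply/card_gt0P; exists finset.set0.
have MR : 0 < M%:R :> R by rewrite ltr0n.
set r := cabs _; have r0 : 0 <= r by exact: cabs_ge0.
have H l : 0 < l -> (r%:E <= (L / l)%:E * (S k + (K * M%:R * l ^+ 2)%:E))%E.
  by move=> l0; exact: cabs_actL_le.
(* The choice of [l] below divides by [L] and must be positive, hence the separate cases [r = 0] and
   [L = 0]. *)
move: r0; rewrite le_eqVlt => /orP[/eqP <-|rp].
  by rewrite expr0n mule_ge0// lee_fin !mulr_ge0// ?sqr_ge0 ?ltW.
move: L0; rewrite le_eqVlt => /orP[/eqP L0|Lp].
  have := H 1 ltr01; rewrite -L0 mul0r mul0e lee_fin => r0.
  by move: (lt_le_trans rp r0); rewrite ltxx.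
move: S0 H; case: (S k) => [s| |] // S0 H; last first.
  by rewrite gt0_muley ?leey// lte_fin !mulr_gt0// exprn_gt0.
(* With this [l] the term coming from [l ^+ 2] equals [r / 2] and is absorbed on the left;
   multiplying what remains by [2 r] gives the bound on [r ^+ 2]. *)
pose l := r / (2 * L * K * M%:R).
have d0 : 0 < 2 * L * K * M%:R by rewrite !mulr_gt0.
have l0 : 0 < l by rewrite divr_gt0.
have := H l l0; rewrite -EFinD -!EFinM !lee_fin => h.
have e1 : L / l * (s + K * M%:R * l ^+ 2) = 2 * L ^+ 2 * K * M%:R * s / r + r / 2.
  rewrite /l; field; rewrite !gt_eqF//.
move: h; rewrite e1 => h.
have : r / 2 <= 2 * L ^+ 2 * K * M%:R * s / r by lra.
rewrite ler_pdivlMr// => h'.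
by rewrite expr2; lra.
Qed.

(** To the pointwise constant [4 L^2 K M], summing over the components adds a factor [M], and
    averaging [S] over the cube adds a factor [K], since each of its terms averages to the square
    norm of [u]. The product is a perfect square. *)
Lemma l2sq_actL_le :
  (l2sq (actL A u) <= ((2 * K * M%:R * L) ^+ 2)%:E * l2sq u)%E.
Proof.
have mQ : mpos Q by exact: mpos_sqn.
have L0 : 0 <= L by exact: normL_ge0.
have K0 : 0 <= K by rewrite ler0n.
pose c := 4 * L ^+ 2 * K * M%:R * M%:R.
have c0 : 0 <= c by rewrite !mulr_ge0// sqr_ge0.
have mS : mpos S by apply: mpos_sum => alpha; exact: iint_mpos.
have mc : mpos (fun _ : T => c%:E) by apply: mpos_cst; rewrite lee_fin.
rewrite !(l2sqE _ origin).
apply: (@le_trans _ _ (iset [set: _]%SET (fun y => c%:E * S y)%E origin)).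
  apply: iset_cube_le; first exact: cube_origin.
  move=> y cy; rewrite lee_fin sqn_ge0 /= /sqn -sumEFin.
  apply: (@le_trans _ _ (\sum_(j < M) (4 * L ^+ 2 * K * M%:R)%:E * S y)%E).
    by apply: lee_sum => j _; exact: sqr_actL_le.
  rewrite sume_cst; first by rewrite card_ord muleA -EFinM mulrC.
  by rewrite mule_ge0// ?lee_fin ?mulr_ge0// ?sqr_ge0//; exact: mS.2.
rewrite /iset (@iint_Zl _ _ _ (fun=> c%:E))//.
rewrite (_ : iint _ S origin = K%:E * iset [set: _]%SET Q origin)%E; last first.
  rewrite /S iint_sum; last by move=> alpha; exact: iint_mpos.
  rewrite (eq_bigr (fun=> iset [set: _]%SET Q origin)); last first.
    move=> alpha _; rewrite -[LHS]/(iset [set: _]%SET (iset alpha Q) origin) iset_iset//.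
    by congr iset; apply/setP => a; rewrite !inE.
  by rewrite sume_cst//; apply: iint_ge0; exact: mQ.2.
rewrite muleA -EFinM (_ : c * K = (2 * K * M%:R * L) ^+ 2)//.
by rewrite /c; ring.
Qed.

End Bound.

Lemma normB_le A : is_stair p A ->
  (normB A <= ((2 * #|{set 'I_N}|%:R * M%:R) * normL A)%:E)%E.
Proof.
move=> sA; apply: ge_ereal_sup => _ [u [u2 un] <-].
have c0 : 0 <= 2 * #|{set 'I_N}|%:R * M%:R * normL A by rewrite !mulr_ge0// normL_ge0.
have u1 : (l2sq u <= 1)%E.
  move: un; rewrite /l2norm; have := l2sq_ge0 u; case: (l2sq u) => [r| |]//.
  by rewrite !lee_fin => r0; rewrite -{1}sqrtr1 ler_sqrt.
have := l2sq_actL_le sA u2; have := l2sq_ge0 (actL A u); rewrite /l2norm.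
have h : (((2 * #|{set 'I_N}|%:R * M%:R * normL A) ^+ 2)%:E * l2sq u <=
   ((2 * #|{set 'I_N}|%:R * M%:R * normL A) ^+ 2)%:E)%E.
  by rewrite -[leRHS]mule1 lee_wpmul2l// lee_fin sqr_ge0.
move=> a0 /le_trans/(_ h) {h}; move: a0; case: (l2sq _) => [r| |]//.
rewrite !lee_fin => r0 rc.
by rewrite -(@ler_pXn2r _ 2)// ?nnegrE ?sqrtr_ge0// sqr_sqrtr.
Qed.

End Action.

(** * Uniqueness of the coefficients *)

Section Uniqueness.
Local Open Scope classical_set_scope.
Context {R : realType}.
Variables N M p : nat.
Hypotheses (M0 : (0 < M)%N) (p0 : (0 < p)%N).
Local Notation C := R[i].
Local Notation cells := {ffun 'I_N -> 'I_p}.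
Local Notation halfcells := {ffun 'I_N -> 'I_(2 * p)}.
Local Notation T := (N.-tuple R).
Implicit Types (A B : coefs R N M) (G : @cellval R N M p) (k y : T) (alpha beta : {set 'I_N})
  (u v : vfun R N M) (zeta : halfcells).

Let q0 : (0 < 2 * p)%N. Proof. by rewrite muln_gt0. Qed.

Lemma half_subproof (i : 'I_(2 * p)) : (i./2 < p)%N.
Proof. by rewrite ltn_half_double -mul2n. Qed.

Definition half (i : 'I_(2 * p)) : 'I_p := Ordinal (half_subproof i).
Definition halves zeta : cells := [ffun i => half (zeta i)].

Lemma cell_halves k : cube k -> cell p0 k = halves (cell q0 k).
Proof.
move=> ck; apply/ffunP => a; rewrite !ffunE; set t := tnth k a.
have t01 : in01 t by exact: ck.
apply/esym/eqP; rewrite -[_ == _]negbK; apply/negP => /negbTE ne.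
have := chiE p0 (half (cell1 q0 t)) t01; rewrite ne => /eqP; apply/negP.
have := chiE q0 (cell1 q0 t) t01; rewrite eqxx !chi_itvE//.
set i := cell1 q0 t; case: (boolP (_ <= _ < _)) => [/andP[h1 h2] _|_ /eqP]; last first.
  by rewrite eq_sym oner_eq0.
(* With [i = b + 2 h] and [b] equal to 0 or 1, the bounds [i <= 2 p t < i + 1] give
   [h <= p t < h + 1]. *)
have io : (odd i + 2 * i./2 = i :> nat)%N by rewrite (mul2n i./2) odd_double_half.
have o0 : 0 <= (odd i)%:R :> R by exact: ler0n.
have o1 : (odd i)%:R <= 1 :> R by case: (odd i); rewrite ?ler01 ?lexx.
have e : (i%:R : R) = (odd i)%:R + 2 * (i./2)%:R by rewrite -{1}io natrD natrM.
move: h1 h2; rewrite -!natr1 e natrM => h1 h2.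
have -> : ((i./2)%:R <= p%:R * t < (i./2)%:R + 1) = true.
  by apply/andP; split; lra.
by rewrite oner_eq0.
Qed.

Lemma ciint_box (s : seq 'I_N) zeta (c : C) k : uniq s -> cube k ->
  ciint s (fun y => c * Complex (box zeta [set: _]%SET y) 0) k =
  c * Complex ((2 * p)%:R^-1 ^+ size s * box zeta (~: [set a in s]) k) 0.
Proof.
move=> us ck.
(* An indicator is bounded, so the constant 1 serves as control function and every point is good. *)
have mH : mpos (fun _ : T => 1%E : \bar R) by apply: mpos_cst; rewrite lee_fin.
have HE a : exists2 d : R, 0 <= d & forall k : T, (iint [:: a] (fun=> 1) k <= d%:E * 1)%E.
  by exists 1 => // y; rewrite iint_cst mule1.
have mb : mpos (fun y : T => (box zeta [set: _]%SET y)%:E) by exact: mpos_box.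
have rb : rep (fun=> 1%E) (box zeta [set: _]%SET) (fun y : T => (box zeta [set: _]%SET y)%:E) (fun=> 0%E).
  split=> //.
  - by exists 1 => // y; rewrite mule1 lee_fin; case/andP: (box_ge0_le1 q0 zeta [set: _]%SET y).
  - by exists 0 => // y; rewrite mul0e.
  - by move=> y _ _; rewrite subr0.
have rEb : riint s (box zeta [set: _]%SET) k = (2 * p)%:R^-1 ^+ size s * box zeta (~: [set a in s]) k.
  have [_ _ _ _ ->//] := rep_riint mH HE s rb; last by rewrite ltey.
  rewrite iint_cst subr0 (@iint_eqT _ _ _ _ (fun y => (box zeta [set: _]%SET y)%:E * 1)%E); last first.
    by move=> y; rewrite mule1.
  rewrite iint_box// iint_cst mule1 /= finset.setTD; congr (_ ^+ _ * _).
  by rewrite -[RHS]count_predT; apply: eq_count => a; rewrite /= !inE.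
have tb : tame (fun=> 1%E) (box zeta [set: _]%SET : T -> R) by do 2 eexists; exact: rb.
case: c => a b; rewrite /ciint /=.
have Zr (d : R) (f : T -> R) : (forall y, f y = d * box zeta [set: _]%SET y) ->
    riint s f k = d * ((2 * p)%:R^-1 ^+ size s * box zeta (~: [set a in s]) k).
  move=> fE; rewrite (@riint_eq _ _ (fun=> True) _ _ (fun y => d * box zeta [set: _]%SET y))//.
  by rewrite (riint_Z mH HE) ?rEb// ltey.
rewrite (Zr a) ?(Zr b)//.
- by apply/eqP; rewrite eq_complex /=; rewrite !mulr0 subr0 add0r !eqxx.
- by move=> y /=; rewrite mulr0 add0r.
- by move=> y /=; rewrite mulr0 subr0.
Qed.

Definition utest zeta (j : 'I_M) : vfun R N M := fun y j' =>
  if j' == j then Complex (box zeta [set: _]%SET y) 0 else 0.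

Lemma isL2_utest zeta j : isL2 (utest zeta j).
Proof.
split=> [j'|].
  rewrite /utest; case: (j' == j); last by split; exact: measurable_cst.
  by split=> /=; [exact: measurable_box|exact: measurable_cst].
rewrite (l2sqE _ (@origin R N)); apply: (@le_lt_trans _ _ (iset [set: _]%SET (fun=> M%:R%:E) (@origin R N))); last first.
  by rewrite /iset iint_cst ltry.
apply: iset_cube_le; first exact: cube_origin.
move=> y cy; rewrite lee_fin sqn_ge0 lee_fin /= /sqn.
rewrite -[leRHS](_ : \sum_(j' < M) 1 = _); last by rewrite sumr_const card_ord.
apply: ler_sum => j' _; rewrite sqr_cabs /utest; case: (j' == j) => /=; last by rewrite expr0n addr0.
have /andP[b0 b1] := box_ge0_le1 q0 zeta [set: _]%SET y.
by rewrite expr0n addr0 expr_le1.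
Qed.

(** Each term keeps the indicator of [zeta] in the directions it did not integrate; these factors
    tell the index sets apart. *)
Lemma actL_utest A zeta j k i : is_stair p A -> cube k ->
  actL A (utest zeta j) k i = \sum_(alpha : {set 'I_N})
    cells_of A alpha (cell p0 k) (halves zeta) i j *
    Complex ((2 * p)%:R^-1 ^+ #|alpha| * box zeta (~: alpha) k) 0.
Proof.
move=> sA ck; rewrite (actLE _ i (given_by_cells p0 sA) ck).
apply: eq_bigr => alpha _.
have := @ciint_box (enum alpha) zeta (cells_of A alpha (cell p0 k) (halves zeta) i j) k
  (enum_uniq _) ck.
rewrite -cardE (_ : [set a in enum alpha]%SET = alpha); last by apply/setP => a; rewrite inE mem_enum.
move=> <-; apply: ciint_eq_cube => // y cy.
rewrite (bigD1 j)//= big1 ?addr0; last by move=> j' ne; rewrite /utest (negbTE ne) mulr0.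
rewrite /utest eqxx (boxTE q0)//; case: eqP => [->|_]; first by rewrite -cell_halves.
by rewrite /= (_ : Complex 0 0 = 0)// !mulr0.
Qed.

Lemma cells_of_restr A alpha (kappa eta eta' : cells) :
  (forall i, i \in alpha -> eta i = eta' i) ->
  cells_of A alpha kappa eta = cells_of A alpha kappa eta'.
Proof.
move=> h; rewrite /cells_of; congr (A _ _ _); apply: eq_from_tnth => i.
by rewrite !tnth_mktuple h// enum_valP.
Qed.

Lemma dbl_subproof (b : bool) (i : 'I_p) : (b + 2 * i < 2 * p)%N.
Proof. by rewrite !mul2n; case: b; rewrite ?add1n ?add0n ?ltn_Sdouble ?ltn_double. Qed.

Definition dbl b (i : 'I_p) : 'I_(2 * p) := Ordinal (dbl_subproof b i).

Lemma half_dbl b i : half (dbl b i) = i.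
Proof. by apply: val_inj; rewrite /= mul2n half_bit_double. Qed.

(* The test cell lies in odd half-cells in the directions of [alpha] and in
   even ones elsewhere, while [k] runs over an even half-cell; only the terms
   with [alpha \subset beta] survive, and those with strict inclusion vanish by
   induction. *)
Lemma cells_of_inj A B : is_stair p A -> is_stair p B ->
  (forall u, isL2 u -> l2sq (vsub (actL A u) (actL B u)) = 0%E) ->
  forall alpha (kappa eta : cells), cells_of A alpha kappa eta = cells_of B alpha kappa eta.
Proof.
move=> sA sB AB alpha; have [n] := ubnP #|~: alpha|.
elim: n alpha => // n IH alpha; rewrite ltnS => cn kappa eta.
apply/matrixP => i j.
pose zeta : halfcells := [ffun a => dbl (a \in alpha) (if a \in alpha then eta a else kappa a)].
pose k2 : halfcells := [ffun a => dbl false (kappa a)].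
pose w : C := cells_of A alpha kappa eta i j - cells_of B alpha kappa eta i j.
pose c : R := (2 * p)%:R^-1 ^+ #|alpha|.
have qR : 0 < (2 * p)%:R^-1 :> R by rewrite invr_gt0 ltr0n.
have hk2 : halves k2 = kappa by apply/ffunP => a; rewrite !ffunE half_dbl.
have hz a : a \in alpha -> halves zeta a = eta a.
  by move=> aa; rewrite !ffunE half_dbl aa.
have diff k : cube k -> cell q0 k = k2 ->
    vsub (actL A (utest zeta j)) (actL B (utest zeta j)) k i = w * Complex c 0.
  move=> ck kk; rewrite /vsub !actL_utest// -sumrB (cell_halves ck) kk hk2.
  rewrite (bigD1 alpha)//= big1 ?addr0.
    rewrite !(cells_of_restr _ _ hz) (boxE q0)// kk.
    rewrite (_ : [forall (a | _), _]) ?mulr1 ?mulrBl//.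
    by apply/forall_inP => a; rewrite inE !ffunE => /negbTE ->.
  move=> beta ba; case: (boolP (alpha \subset beta)) => [ab|].
    rewrite IH ?subrr//; apply: leq_trans cn; apply: proper_card.
    by rewrite finset.properC finset.properEneq eq_sym ba.
  case/fintype.subsetPn => a aa ab; rewrite (boxE q0)// kk.
  rewrite (_ : [forall (a | _), _] = false); last first.
    apply/negbTE/negP => /forall_inP /(_ a); rewrite inE ab => /(_ isT).
    by rewrite !ffunE aa -val_eqE /= => /eqP /(congr1 odd); rewrite !mul2n !oddD !odd_double.
  by rewrite mulr0 (_ : Complex 0 0 = 0)// !mulr0 subrr.
have := AB _ (isL2_utest zeta j); rewrite (l2sqE _ (@origin R N)) => l0.
(* The difference of the two actions has the constant entry [w * c] on the half-cell [k2], whose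
   measure [(2p)^-N] is positive; a zero L^2 norm therefore forces [w = 0]. *)
have : (((cabs (w * Complex c 0)) ^+ 2 * (2 * p)%:R^-1 ^+ N)%:E <= 0 :> \bar R)%E.
  rewrite -l0.
  apply: (@le_trans _ _ (iset [set: _]%SET (fun y => (box k2 [set: _]%SET y)%:E *
      (cabs (w * Complex c 0) ^+ 2)%:E)%E (@origin R N))).
    rewrite /iset iint_box ?enum_uniq//; last by apply: mpos_cst; rewrite lee_fin sqr_ge0.
    rewrite iint_cst (_ : count _ _ = N); last first.
      by rewrite (@eq_in_count _ _ predT) ?count_predT -?cardE ?cardsT ?card_ord// => a; rewrite !inE.
    rewrite (_ : box _ _ _ = 1) ?mulr1 -?EFinM 1?mulrC//.
    by rewrite /box big1// => a; rewrite !inE mem_enum inE.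
  apply: iset_cube_le; first exact: cube_origin.
  move=> y cy; rewrite -EFinM !lee_fin (boxTE q0)//.
  case: eqP => [e|_]; last by rewrite mul0r lexx sqn_ge0.
  rewrite mul1r sqr_ge0 /sqn (bigD1 i)//= (diff y cy (esym e)) lerDl.
  by apply: sumr_ge0 => l _; exact: sqr_ge0.
rewrite lee_fin pmulr_lle0 ?exprn_gt0// => h.
have /eqP : cabs (w * Complex c 0) ^+ 2 = 0 by apply/eqP; rewrite eq_le h sqr_ge0.
rewrite sqrf_eq0 => /eqP /cabs_eq0 /eqP; rewrite mulf_eq0 => /orP[/eqP|/eqP[]].
  by move/eqP; rewrite subr_eq0 => /eqP.
by move/eqP; rewrite gt_eqF// exprn_gt0.
Qed.

End Uniqueness.

(** * Composition *)

Section ComplexTame.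
Local Open Scope classical_set_scope.
Context {R : realType} {N : nat}.
Local Notation C := R[i].
Local Notation T := (N.-tuple R).
Variable H : T -> \bar R.
Hypothesis mH : mpos H.
Hypothesis HE : forall a, exists2 c : R, 0 <= c & forall k, (iint [:: a] H k <= c%:E * H k)%E.
Implicit Types (F : T -> C) (k y : T) (s : seq 'I_N).

Definition ctame F := tame H (fun y => complex.Re (F y)) /\ tame H (fun y => complex.Im (F y)).

Lemma ReD (z w : C) : complex.Re (z + w) = complex.Re z + complex.Re w.
Proof. by case: z; case: w. Qed.
Lemma ImD (z w : C) : complex.Im (z + w) = complex.Im z + complex.Im w.
Proof. by case: z; case: w. Qed.
Lemma ReM (z w : C) :
  complex.Re (z * w) = complex.Re z * complex.Re w + (- complex.Im z) * complex.Im w.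
Proof. by case: z => a b; case: w => c d; rewrite /= mulNr. Qed.
Lemma ImM (z w : C) :
  complex.Im (z * w) = complex.Re z * complex.Im w + complex.Im z * complex.Re w.
Proof. by case: z => a b; case: w => c d /=. Qed.

Lemma ctame_D F F' : ctame F -> ctame F' -> ctame (fun y => F y + F' y).
Proof.
move=> [r i] [r' i']; split.
  by under eq_fun do rewrite ReD; exact: tame_D.
by under eq_fun do rewrite ImD; exact: tame_D.
Qed.

Lemma ctame_Z (c : C) F : ctame F -> ctame (fun y => c * F y).
Proof.
move=> [r i]; split.
  by under eq_fun do rewrite ReM; apply: tame_D => //; apply: tame_Z.
by under eq_fun do rewrite ImM; apply: tame_D => //; apply: tame_Z.
Qed.

Lemma ctame0 : ctame (fun=> 0).
Proof.
have t0 : tame H (fun=> 0).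
  exists (fun=> 0%E), (fun=> 0%E); split=> //; try by exists 0 => // y; rewrite mul0e.
  by move=> y _ _; rewrite subr0.
by split.
Qed.

Lemma ctame_sum (I : Type) (r : seq I) (F : I -> T -> C) :
  (forall i, ctame (F i)) -> ctame (fun y => \sum_(i <- r) F i y).
Proof.
move=> tF; elim: r => [|i r IH].
  by under eq_fun do rewrite big_nil; exact: ctame0.
by under eq_fun do rewrite big_cons; exact: ctame_D.
Qed.

Lemma ctame_ciint s F : ctame F -> ctame (ciint s F).
Proof. by move=> [r i]; split; exact: tame_riint. Qed.

Lemma ctame_M (b : T -> R) F : measurable_fun setT b -> (forall y, 0 <= b y <= 1) ->
  ctame F -> ctame (fun y => Complex (b y) 0 * F y).
Proof.
move=> mb b01 [r i]; split.
  under eq_fun do rewrite ReM /= oppr0 mul0r addr0.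
  exact: tame_M.
under eq_fun do rewrite ImM /= mul0r addr0.
exact: tame_M.
Qed.

Lemma ciint_congr s F F' k : ctame F -> (forall y, cube y -> (H y < +oo)%E -> F y = F' y) ->
  cube k -> (H k < +oo)%E -> ciint s F k = ciint s F' k.
Proof.
move=> [r i] FF ck Hk; congr Complex; apply: (riint_congr mH HE) => // y cy Hy;
by rewrite FF.
Qed.

Lemma ciint_D s F F' k : ctame F -> ctame F' -> cube k -> (H k < +oo)%E ->
  ciint s (fun y => F y + F' y) k = ciint s F k + ciint s F' k.
Proof.
move=> [r i] [r' i'] ck Hk; rewrite /ciint.
under [in LHS]eq_fun do rewrite ReD.
under [X in Complex _ (riint s X k)]eq_fun do rewrite ImD.
by rewrite !(riint_D mH HE).
Qed.

Lemma ciint_Z s (c : C) F k : ctame F -> cube k -> (H k < +oo)%E ->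
  ciint s (fun y => c * F y) k = c * ciint s F k.
Proof.
move=> [r i] ck Hk; rewrite /ciint.
under [in LHS]eq_fun do rewrite ReM.
under [X in Complex _ (riint s X k)]eq_fun do rewrite ImM.
rewrite !(riint_D mH HE) ?(riint_Z mH HE)//; try exact: tame_Z.
by apply/eqP; rewrite eq_complex ReM ImM /= !eqxx.
Qed.

Lemma ciint_sum (I : Type) (r : seq I) (c : I -> C) (F : I -> T -> C) s k :
  (forall i, ctame (F i)) -> cube k -> (H k < +oo)%E ->
  ciint s (fun y => \sum_(i <- r) c i * F i y) k = \sum_(i <- r) c i * ciint s (F i) k.
Proof.
move=> tF ck Hk; elim: r => [|i r IH].
  rewrite big_nil; under eq_fun do rewrite big_nil.
  by have := ciint_Z s 0 ctame0 ck Hk; rewrite !mul0r.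
rewrite big_cons -IH; under eq_fun do rewrite big_cons.
rewrite ciint_D ?ciint_Z//; first exact: ctame_Z.
by apply: ctame_sum => i'; exact: ctame_Z.
Qed.

Context {q : nat} (q0 : (0 < q)%N).
Local Notation cells := {ffun 'I_N -> 'I_q}.
Local Notation bx eta y := (Complex (box eta [set: _]%SET y) 0).

Lemma riint_box_riint (eta zeta : cells) (A B : {set 'I_N}) (f : T -> R) k :
  tame H f -> cube k -> (H k < +oo)%E ->
  riint (enum A) (fun y => box eta [set: _]%SET y *
     riint (enum B) (fun z => box zeta [set: _]%SET z * f z) y) k =
  weight eta zeta (cell q0 k) A B *
    riint (enum (A :|: B)) (fun z => box zeta [set: _]%SET z * f z) k.
Proof.
move=> [f1 [f2 rf]] ck Hk.
have bM (e : cells) g g1 g2 : rep H g g1 g2 ->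
    rep H (fun y => box e [set: _]%SET y * g y) (fun y => (box e [set: _]%SET y)%:E * g1 y)%E
      (fun y => (box e [set: _]%SET y)%:E * g2 y)%E.
  by apply: rep_M => //; [exact: measurable_box|move=> y; exact: box_ge0_le1].
have w0 : 0 <= weight eta zeta (cell q0 k) A B :> R.
  by rewrite /weight mulr_ge0// exprn_ge0// invr_ge0.
have r1 := rep_riint mH HE (enum A) (bM eta _ _ _ (rep_riint mH HE (enum B) (bM zeta _ _ _ rf))).
have r2 := rep_scale w0 (rep_riint mH HE (enum (A :|: B)) (bM zeta _ _ _ rf)).
have [m1 m2 _ _ _] := rf.
exact: (rep_uniq r1 r2 (iset_box_iset q0 eta zeta A B m1 ck) (iset_box_iset q0 eta zeta A B m2 ck) ck Hk).
Qed.

Lemma ciint_box_ciint (eta zeta : cells) (A B : {set 'I_N}) F k :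
  ctame F -> cube k -> (H k < +oo)%E ->
  ciint (enum A) (fun y => bx eta y * ciint (enum B) (fun z => bx zeta z * F z) y) k =
  Complex (weight eta zeta (cell q0 k) A B) 0 *
    ciint (enum (A :|: B)) (fun z => bx zeta z * F z) k.
Proof.
move=> [r i] ck Hk.
have cEb (e : cells) s (F' : T -> C) y : ciint s (fun z => bx e z * F' z) y =
    Complex (riint s (fun z => box e [set: _]%SET z * complex.Re (F' z)) y)
            (riint s (fun z => box e [set: _]%SET z * complex.Im (F' z)) y).
  congr Complex; congr riint; apply/funext => z.
    by rewrite ReM /= oppr0 mul0r addr0.
  by rewrite ImM /= mul0r addr0.
rewrite !cEb.
under [X in Complex (riint _ X _) _]eq_fun do rewrite cEb.
under [X in Complex _ (riint _ X _)]eq_fun do rewrite cEb.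
rewrite !(riint_box_riint _ _ _ _ _ ck Hk)//.
by apply/eqP; rewrite eq_complex ReM ImM /= oppr0 !mul0r !addr0 !eqxx.
Qed.

End ComplexTame.

(** * Coefficients and norm of a composition *)

Section Composition.
Local Open Scope classical_set_scope.
Context {R : realType}.
Variables N M p : nat.
Hypotheses (M0 : (0 < M)%N) (p0 : (0 < p)%N).
Local Notation C := R[i].
Local Notation cells := {ffun 'I_N -> 'I_p}.
Local Notation T := (N.-tuple R).
Local Notation sets := {set 'I_N}.
Local Notation bx eta y := (Complex (box eta [set: _]%SET y) 0).
Implicit Types (A B : coefs R N M) (G : @cellval R N M p) (k y : T) (alpha beta gamma : sets).

(** The sum over middle cells factors over directions. A direction in both sets gives [p] choices of
    weight [1/p]; in any other direction the index is forced by [zeta] or [kappa], or by both, and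
    contributes at most 1. *)
Lemma sum_weight_le1 (zeta kappa : cells) alpha beta :
  \sum_(eta : cells) weight eta zeta kappa alpha beta <= 1 :> R.
Proof.
pose g (i : 'I_N) (c : 'I_p) : R :=
  (((i \in beta) || (c == zeta i)) && ((i \in alpha) || (c == kappa i)))%:R *
  (if i \in alpha :&: beta then p%:R^-1 else 1).
have -> : \sum_(eta : cells) weight eta zeta kappa alpha beta = \prod_i \sum_c g i c.
  rewrite bigA_distr_bigA; apply: eq_bigr => eta _.
  rewrite /g big_split /= -big_mkcond /= prodr_const; congr (_ * _).
  case: (boolP (_ && _)) => [/andP[/forall_inP h1 /forall_inP h2]|].
    rewrite big1// => i _; case: (boolP (i \in beta)) => ib /=; case: (boolP (i \in alpha)) => ia //=.
    - by rewrite h2// inE.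
    - by rewrite h1// inE.
    - by rewrite h1 ?h2// inE.
  move=> h; apply/esym/eqP; apply: contraNT h => /prodf_neq0 h.
  apply/andP; split; apply/forall_inP => i; rewrite inE => /negbTE ia.
    by have := h i isT; rewrite ia /=; case: (eta i == zeta i) => //=; rewrite eqxx.
  have := h i isT; rewrite ia /= andbC.
  by case: (eta i == kappa i) => //=; rewrite eqxx.
apply: prodr_ile1 => i _; apply/andP; split.
  by apply: sumr_ge0 => c _; rewrite /g mulr_ge0//; case: ifP => // _; rewrite invr_ge0.
rewrite /g inE; case: (boolP (i \in alpha)) => ia; case: (boolP (i \in beta)) => ib /=.
- by rewrite mul1r sumr_const card_ord -[leLHS]mulr_natr mulVf ?pnatr_eq0 -?lt0n.
- rewrite (bigD1 (zeta i))//= big1 => [|c /negbTE->]; last by rewrite mul0r.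
  by rewrite eqxx mulr1 addr0.
- rewrite (bigD1 (kappa i))//= big1 => [|c /negbTE->]; last by rewrite mul0r.
  by rewrite eqxx mulr1 addr0.
- rewrite (bigD1 (kappa i))//= big1 => [|c /negbTE->]; last by rewrite andbF mul0r.
  by rewrite eqxx andbT mulr1 addr0; case: (_ == _).
Qed.

(* Composing the terms indexed by [alpha] and [beta] integrates over
   [alpha :|: beta]; the coordinates in [alpha :&: beta] of the middle cell
   [eta] are averaged, the others are those of [kappa] or [zeta]. *)
Definition comp_cells G G' : @cellval R N M p := fun gamma kappa zeta =>
  \matrix_(i, j) \sum_(t : (sets * sets) * (cells * 'I_M) | t.1.1 :|: t.1.2 == gamma)
    Complex (weight t.2.1 zeta kappa t.1.1 t.1.2) 0 *
    (G t.1.1 kappa t.2.1 i t.2.2 * G' t.1.2 t.2.1 zeta t.2.2 j).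

Lemma cabs_real (r : R) : 0 <= r -> cabs (Complex r 0) = r.
Proof. by move=> r0; rewrite /cabs /= expr0n addr0 sqrtr_sqr ger0_norm. Qed.

(** The weights do not involve matrix indices: a row sum of [B] is bounded first, then one of [A],
    and what remains is the sum of the weights, at most 1. *)
Lemma normL_comp A B : is_stair p A -> is_stair p B ->
  normL (coefs_of p0 (comp_cells (cells_of A) (cells_of B))) <= normL A * normL B.
Proof.
move=> sA sB; rewrite !normLE.
pose a alpha := rownorm A alpha; pose b beta := rownorm B beta.
(* Pairs of index sets are grouped by their union, the index set of the resulting coefficient. *)
have -> : (\sum_(alpha : sets) rownorm A alpha) * (\sum_(beta : sets) rownorm B beta) =
    \sum_(gamma : sets) \sum_(t : sets * sets | t.1 :|: t.2 == gamma) a t.1 * b t.2.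
  rewrite mulr_suml; under eq_bigr do rewrite mulr_sumr.
  rewrite pair_bigA /= (partition_big (fun t : sets * sets => t.1 :|: t.2) predT)//=.
apply: ler_sum => gamma _; apply: (rownorm_le M0) => k x i ck cx; rewrite /coefs_of.
set kappa := cell p0 k; set zeta := cell p0 _.
have w0 eta alpha beta : 0 <= weight eta zeta kappa alpha beta :> R.
  by rewrite /weight mulr_ge0// exprn_ge0// invr_ge0.
have rowle D alpha (e e' : cells) l : is_stair p D ->
    \sum_(j < M) cabs (cells_of D alpha e e' l j) <= rownorm D alpha.
  move=> sD; apply: (row_le_rownorm p0) => //; first exact: cube_corner.
  by apply: cube_restr; exact: cube_corner.
apply: (@le_trans _ _ (\sum_(j < M) \sum_(t : (sets * sets) * (cells * 'I_M) | t.1.1 :|: t.1.2 == gamma)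
    weight t.2.1 zeta kappa t.1.1 t.1.2 *
    (cabs (cells_of A t.1.1 kappa t.2.1 i t.2.2) * cabs (cells_of B t.1.2 t.2.1 zeta t.2.2 j)))).
  apply: ler_sum => j _; rewrite mxE; apply: le_trans (cabs_sum _ _ _) _.
  by apply: ler_sum => t _; rewrite !cabsM cabs_real.
rewrite exchange_big /=.
apply: (@le_trans _ _ (\sum_(t : (sets * sets) * (cells * 'I_M) | t.1.1 :|: t.1.2 == gamma)
    weight t.2.1 zeta kappa t.1.1 t.1.2 *
    (cabs (cells_of A t.1.1 kappa t.2.1 i t.2.2) * b t.1.2))).
  apply: ler_sum => t _; rewrite -mulr_sumr ler_wpM2l// -mulr_sumr ler_wpM2l ?cabs_ge0//.
  exact: rowle.
rewrite (eq_bigl (fun t : (sets * sets) * (cells * 'I_M) => (t.1.1 :|: t.1.2 == gamma) && true));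
  last by move=> t; rewrite andbT.
rewrite -(pair_big (fun ab : sets * sets => ab.1 :|: ab.2 == gamma) (fun=> true)
  (fun ab (el : cells * 'I_M) => weight el.1 zeta kappa ab.1 ab.2 *
     (cabs (cells_of A ab.1 kappa el.1 i el.2) * b ab.2))) /=.
apply: ler_sum => -[alpha beta] _ /=.
rewrite -(pair_bigA _ (fun eta l => weight eta zeta kappa alpha beta *
     (cabs (cells_of A alpha kappa eta i l) * b beta))) /=.
apply: (@le_trans _ _ (\sum_(eta : cells) weight eta zeta kappa alpha beta * (a alpha * b beta))).
  apply: ler_sum => eta _; rewrite -mulr_sumr ler_wpM2l// -mulr_suml ler_wpM2r ?rownorm_ge0//.
  exact: rowle.
rewrite -mulr_suml -[leRHS]mul1r ler_wpM2r ?sum_weight_le1//.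
by rewrite mulr_ge0// rownorm_ge0.
Qed.

(** * The composition applied to a fixed square integrable function *)

Section Apply.
Variable u : vfun R N M.
Hypothesis u2 : isL2 u.
(** The summand 1 makes [w] dominate the moduli of the components of [u], since [c <= 1 + c^2]. *)
Let w (y : T) : \bar R := (1 + (sqn u y)%:E)%E.
(** Summing over all index sets gives stability: averaging in direction [a] sends the term of
    [gamma] to that of [gamma] with [a] added, again a term of [H]. *)
Let H (y : T) : \bar R := (\sum_(gamma : sets) iset gamma w y)%E.

Let mw : mpos w.
Proof. by apply: mposD; [apply: mpos_cst; rewrite lee_fin|exact: mpos_sqn]. Qed.

Let mH : mpos H. Proof. by apply: mpos_sum => gamma; exact: iint_mpos. Qed.

Let iset_H alpha k : iset alpha H k = (\sum_(gamma : sets) iset (alpha :|: gamma) w k)%E.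
Proof.
rewrite /iset /H iint_sum; last by move=> gamma; exact: iint_mpos.
by apply: eq_bigr => gamma _; rewrite -[RHS]/(iset _ w k) -iset_iset.
Qed.

Let iset_le_H gamma k : (iset gamma w k <= H k)%E.
Proof.
rewrite /H (bigD1 gamma)//= leeDl// sume_ge0// => g _.
by apply: iint_ge0; exact: mw.2.
Qed.

Let HE a : exists2 c : R, 0 <= c & forall k, (iint [:: a] H k <= c%:E * H k)%E.
Proof.
exists #|sets|%:R => // k.
rewrite -(_ : iset [set a]%SET H k = iint [:: a] H k); last by rewrite /iset enum_set1.
rewrite iset_H -sume_cst; last exact: mH.2.
by apply: lee_sum => gamma _; exact: iset_le_H.
Qed.

Let H_finite : (iset [set: _]%SET H (origin N) < +oo)%E.
Proof.
rewrite iset_H (eq_bigr (fun=> (1 + l2sq u)%E)); last first.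
  move=> gamma _; rewrite finset.setTU /iset /w iint_D; [|by apply: mpos_cst; rewrite lee_fin|exact: mpos_sqn].
  by rewrite iint_cst (l2sqE u (origin N)).
rewrite sume_cst; last by rewrite adde_ge0 ?lee_fin ?l2sq_ge0.
by rewrite lte_mul_pinfty ?lee_fin// lte_add_pinfty ?ltry//; exact: u2.2.
Qed.

Let tame_u j : ctame H (fun y => u y j).
Proof.
have le y : ((cabs (u y j))%:E <= H y)%E.
  apply: le_trans (iset_le_H finset.set0 y).
  rewrite /iset enum_set0 /= /w -EFinD lee_fin /sqn (bigD1 j)//= addrA.
  apply: (@le_trans _ _ (1 + cabs (u y j) ^+ 2)).
    by have := sqr_ge0 (cabs (u y j) - 1); set c := cabs _; have : 0 <= c := cabs_ge0 _; nra.
  by rewrite lerDl sumr_ge0// => l _; exact: sqr_ge0.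
have [mr mi] := u2.1 j.
split; do 2 eexists; apply: rep_real => // y; apply: le_trans (le y); rewrite lee_fin.
  exact: abs_Re_le.
exact: abs_Im_le.
Qed.

Let v (z : cells * 'I_M) (y : T) : C := bx z.1 y * u y z.2.

Let tame_v z : ctame H (v z).
Proof.
apply: ctame_M => //; first exact: measurable_box.
by move=> y; exact: box_ge0_le1.
Qed.

Lemma sum_bx (V : cells -> C) y : cube y -> \sum_(eta : cells) bx eta y * V eta = V (cell p0 y).
Proof.
move=> cy; rewrite (bigD1 (cell p0 y))//= big1 => [|eta ne].
  by rewrite (boxTE p0)// eqxx (_ : Complex 1 0 = 1)// mul1r addr0.
by rewrite (boxTE p0)// (negbTE ne) (_ : Complex 0 0 = 0)// mul0r.
Qed.

(** The cell indicators are a partition of unity; splitting the integral along them uses linearity,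
    which finiteness of [H] at [k] guarantees. *)
Lemma actL_good A G k i : given_by p0 A G -> cube k -> (H k < +oo)%E ->
  actL A u k i = \sum_(gamma : sets) \sum_(z : cells * 'I_M)
    G gamma (cell p0 k) z.1 i z.2 * ciint (enum gamma) (v z) k.
Proof.
move=> AG ck Hk; rewrite (actLE u i AG ck); apply: eq_bigr => gamma _.
rewrite -(ciint_sum mH HE)//; apply: ciint_eq_cube => // y cy.
rewrite -(pair_bigA _ (fun zeta j => G gamma (cell p0 k) zeta i j * v (zeta, j) y)) /=.
rewrite -(sum_bx (fun zeta => \sum_(j < M) G gamma (cell p0 k) zeta i j * u y j) cy).
apply: eq_bigr => zeta _; rewrite mulr_sumr; apply: eq_bigr => j _.
by rewrite /v /= mulrCA.
Qed.

(** Once [actL B u] is expanded by cells, each term is an indicator times an average, which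
    [ciint_box_ciint] collapses to a single average over the union. *)
Lemma actL_comp A B G G' k i : given_by p0 A G -> given_by p0 B G' ->
  cube k -> (H k < +oo)%E ->
  actL A (actL B u) k i = actL (coefs_of p0 (comp_cells G G')) u k i.
Proof.
move=> AG BG ck Hk.
rewrite (actL_good i (coefs_ofP p0 _) ck Hk) (actLE _ i AG ck).
set kappa := cell p0 k.
pose X alpha (t : sets * (cells * 'I_M)) (z : cells * 'I_M) : C :=
  Complex (weight t.2.1 z.1 kappa alpha t.1) 0 *
  (G alpha kappa t.2.1 i t.2.2 * G' t.1 t.2.1 z.1 t.2.2 z.2) *
  ciint (enum (alpha :|: t.1)) (v z) k.
transitivity (\sum_(alpha : sets) \sum_(t : sets * (cells * 'I_M)) \sum_(z : cells * 'I_M) X alpha t z).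
  apply: eq_bigr => alpha _.
  pose F (tz : (sets * (cells * 'I_M)) * (cells * 'I_M)) (y : T) : C :=
    bx tz.1.2.1 y * ciint (enum tz.1.1) (v tz.2) y.
  have tF tz : ctame H (F tz).
    apply: ctame_M => //; [exact: measurable_box|by move=> y; exact: box_ge0_le1|].
    exact: (ctame_ciint mH HE).
  pose c (tz : (sets * (cells * 'I_M)) * (cells * 'I_M)) : C :=
    G alpha kappa tz.1.2.1 i tz.1.2.2 * G' tz.1.1 tz.1.2.1 tz.2.1 tz.1.2.2 tz.2.2.
  transitivity (ciint (enum alpha) (fun y => \sum_tz c tz * F tz y) k).
    (* The expansion of [actL B u] is available only where [H] is finite, which is all that
       [ciint_congr] asks for. *)
    apply/esym; apply: (ciint_congr mH HE) => //.
      by apply: ctame_sum => tz; exact: ctame_Z.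
    move=> y cy Hy.
    rewrite -(pair_bigA _ (fun t z => c (t, z) * F (t, z) y)) /=.
    rewrite -(pair_bigA _ (fun beta el => \sum_z c (beta, el, z) * F (beta, el, z) y)) /=.
    transitivity (\sum_(l < M) \sum_(eta : cells) bx eta y *
        (G alpha kappa eta i l * \sum_(beta : sets) \sum_(z : cells * 'I_M)
           G' beta eta z.1 l z.2 * ciint (enum beta) (v z) y)); last first.
      apply: eq_bigr => l _.
      rewrite (sum_bx (fun eta => G alpha kappa eta i l * \sum_(beta : sets) \sum_(z : cells * 'I_M)
           G' beta eta z.1 l z.2 * ciint (enum beta) (v z) y) cy).
      by rewrite (actL_good l BG cy Hy).
    rewrite [RHS]exchange_big /= [RHS]pair_bigA /= [LHS]exchange_big /=; apply: eq_bigr => -[eta l] _ /=.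
    rewrite !mulr_sumr; apply: eq_bigr => beta _; rewrite !mulr_sumr; apply: eq_bigr => z _.
    by rewrite /c /F /= mulrCA -!mulrA.
  rewrite (ciint_sum mH HE)// -(pair_bigA _ (fun t z => c (t, z) * ciint (enum alpha) (F (t, z)) k)) /=.
  apply: eq_bigr => t _; apply: eq_bigr => z _.
  rewrite /F (ciint_box_ciint mH HE p0)// /X /c /= [LHS]mulrA; congr (_ * _); exact: mulrC.
transitivity (\sum_(z : cells * 'I_M) \sum_(t : (sets * sets) * (cells * 'I_M))
    X t.1.1 (t.1.2, t.2) z).
  rewrite [RHS]exchange_big /=.
  rewrite -(pair_bigA _ (fun ab el => \sum_z X ab.1 (ab.2, el) z)) /=.
  rewrite -(pair_bigA _ (fun alpha beta => \sum_el \sum_z X alpha (beta, el) z)) /=.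
  by apply: eq_bigr => alpha _; rewrite -(pair_bigA _ (fun beta el => \sum_z X alpha (beta, el) z)).
rewrite [RHS]exchange_big /=; apply: eq_bigr => z _.
rewrite (partition_big (fun t : (sets * sets) * (cells * 'I_M) => t.1.1 :|: t.1.2) predT)//=.
apply: eq_bigr => gamma _; rewrite mxE mulr_suml; apply: eq_bigr => t /eqP <-.
by [].
Qed.

Lemma l2sq_comp A B : is_stair p A -> is_stair p B ->
  l2sq (vsub (actL (coefs_of p0 (comp_cells (cells_of A) (cells_of B))) u)
             (actL A (actL B u))) = 0%E.
Proof.
move=> sA sB; apply/eqP; rewrite eq_le l2sq_ge0 andbT (l2sqE _ (origin N)).
(* Where [H] is infinite the two sides may differ; the [+oo]-valued indicator dominates the squared
   difference there and still averages to 0. *)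
have := iint_ind_infty mH H_finite; rewrite -/(iset _ _ _) => <-.
apply: iset_cube_le; first exact: cube_origin.
move=> y cy; rewrite lee_fin sqn_ge0 /=; case: eqP => [_|/eqP Hy]; first by rewrite leey.
rewrite lee_fin /sqn big1// => j _.
rewrite /vsub (actL_comp j (given_by_cells p0 sA) (given_by_cells p0 sB) cy) ?ltey//.
by rewrite subrr cabs0 expr0n.
Qed.

End Apply.
End Composition.

(** * The norm as a function of the operator *)

Section Kernel.
Context {R : realType}.
Variables N M p : nat.
Hypotheses (M0 : (0 < M)%N) (p0 : (0 < p)%N).
Implicit Types (A B : coefs R N M) (u : vfun R N M).

Lemma actL_eq0 A u k i : given_by p0 A (fun _ _ _ => 0) -> cube k -> actL A u k i = 0.
Proof.
move=> A0 ck; rewrite (actLE u i A0 ck) big1// => alpha _.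
have z (f : N.-tuple R -> R) : (forall y, f y = 0) -> riint (enum alpha) f k = 0.
  move=> f0; have : (`|riint (enum alpha) f k|%:E <= iint (enum alpha) (fun=> 0) k)%E.
    by apply: abs_riint_le => // y _; rewrite f0 normr0.
  by rewrite iint_cst lee_fin normr_le0 => /eqP.
by rewrite /ciint !z// => y; rewrite big1// => j _; rewrite mxE mul0r.
Qed.

Lemma normL_eq_of_action A B : is_stair p A -> is_stair p B ->
  (forall u, isL2 u -> l2sq (vsub (actL A u) (actL B u)) = 0%E) -> normL A = normL B.
Proof.
move=> sA sB AB; apply: normL_eq => alpha k x ck cx.
rewrite (given_by_cells p0 sA ck cx) (given_by_cells p0 sB ck cx); exact: (cells_of_inj p0 sA sB AB).
Qed.

Lemma normL_eq0P A : is_stair p A ->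
  normL A = 0 <-> (forall u, isL2 u -> l2sq (actL A u) = 0%E).
Proof.
move=> sA; split=> [A0 u u2|h].
  have := l2sq_actL_le M0 p0 sA u2; rewrite A0 mulr0 expr0n mul0e => le0.
  by apply/eqP; rewrite eq_le le0 l2sq_ge0.
(* Definiteness is uniqueness of coefficients, applied to [A] and the zero family. *)
pose Z : coefs R N M := coefs_of p0 (fun _ _ _ => 0).
rewrite (@normL_eq_of_action A Z sA (stair_coefs_of p0 _)).
  apply/eqP; rewrite eq_le normL_ge0 andbT normLE; apply: sumr_le0 => alpha _.
  apply: (rownorm_le M0) => k x i ck cx.
  by rewrite big1// => j _; rewrite /Z /coefs_of mxE cabs0.
move=> u u2; rewrite -(h u u2); apply: l2sq_eq => k i ck.
by rewrite /vsub (@actL_eq0 Z)// subr0.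
Qed.

End Kernel.

(** Elements of the algebra are represented by coefficient families, and equality of operators by
    zero L^2 distance of their actions; the last clause of the first part makes the norm depend on
    the operator alone. *)
Theorem theorem1 (R : realType) (N M p : nat) :
  (0 < N)%N -> (0 < M)%N -> (0 < p)%N ->
  (* (1) ||.||_L is a norm on L (well defined on the operators) *)
  [/\ (forall A : coefs R N M, is_stair p A -> 0 <= normL A),
      (forall A : coefs R N M, is_stair p A ->
         normL A = 0 <-> (forall u, isL2 u -> l2sq (actL A u) = 0%E)),
      (forall (c : R[i]) (A : coefs R N M), is_stair p A ->
         normL (scaleL c A) = cabs c * normL A),
      (forall A B : coefs R N M, is_stair p A -> is_stair p B ->
         normL (addL A B) <= normL A + normL B) &
      (forall A B : coefs R N M, is_stair p A -> is_stair p B ->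
         (forall u, isL2 u -> l2sq (vsub (actL A u) (actL B u)) = 0%E) ->
         normL A = normL B)]
  /\
  (* (2) ||.||_L is stronger than the L^2 operator norm *)
  (exists c : R, forall A : coefs R N M, is_stair p A ->
      (normB A <= (c * normL A)%:E)%E)
  /\
  (* (3) ||.||_L-convergence <-> uniform convergence of all coefficients *)
  (forall (A : nat -> coefs R N M) (B : coefs R N M),
     (forall n, is_stair p (A n)) -> is_stair p B ->
     (forall e : R, 0 < e -> exists n0, forall n, (n0 <= n)%N ->
        normL (subL (A n) B) < e)
     <->
     (forall (alpha : {set 'I_N}) (i j : 'I_M) (e : R), 0 < e ->
        exists n0, forall n, (n0 <= n)%N ->
          forall (k : N.-tuple R) (x : #|alpha|.-tuple R), cube k -> cube x ->
            cabs (A n alpha k x i j - B alpha k x i j) < e))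
  /\
  (* (4) (L, ||.||_L) is a Banach algebra under composition *)
  ((forall A : nat -> coefs R N M, (forall n, is_stair p (A n)) ->
      (forall e : R, 0 < e -> exists n0, forall m n, (n0 <= m)%N -> (n0 <= n)%N ->
         normL (subL (A m) (A n)) < e) ->
      exists B : coefs R N M, is_stair p B /\
        (forall e : R, 0 < e -> exists n0, forall n, (n0 <= n)%N ->
           normL (subL (A n) B) < e))
   /\
   (forall A B : coefs R N M, is_stair p A -> is_stair p B ->
      exists AB : coefs R N M, [/\ is_stair p AB,
        (forall u, isL2 u -> l2sq (vsub (actL AB u) (actL A (actL B u))) = 0%E) &
        normL AB <= normL A * normL B])).
Proof.
move=> _ M0 p0; split; [split|split; [|split; [|split]]].
- by move=> A _; exact: normL_ge0.
- by move=> A; exact: (normL_eq0P M0 p0).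
- by move=> c A; exact: (normL_scale M0 p0).
- by move=> A B; exact: (normL_add M0 p0).
- by move=> A B; exact: (normL_eq_of_action p0).
- by exists (2 * #|{set 'I_N}|%:R * M%:R) => A; exact: (normB_le M0 p0).
- by move=> A B; exact: (normL_cvgP M0 p0).
- by move=> A; exact: (normL_complete M0 p0).
- move=> A B sA sB; exists (coefs_of p0 (comp_cells (cells_of A) (cells_of B))); split.
  + exact: stair_coefs_of.
  + by move=> u u2; exact: l2sq_comp.
  + exact: normL_comp.
Qed.
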